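(* Let $G$ be a finite oriented graph whose underlying undirected graph is planar, bipartite, $2$-vertex-connected and subcubic (every vertex has degree at most $3$). Then $G$ has a CAI-partition, i.e., there is a partition $V(G)=\mathcal{A}\cup\mathcal{I}$ into disjoint sets such that $\mathcal{A}$ induces a connected subdigraph without directed cycles and $\mathcal{I}$ is an independent set.
   Context: An oriented graph is a directed graph without directed cycles of length $1$ or $2$ (no loops, at most one arc between any two vertices). Connectivity, degree, planarity, bipartiteness and independence refer to the underlying undirected simple graph; in particular, a subdigraph is connected if its underlying undirected graph is connected. A graph is $2$-vertex-connected if it is connected and has no cut-vertex, where a cut-vertex is a vertex whose removal disconnects the graph. A set of vertices of a directed graph is acyclic if it induces a subdigraph without directed cycles. *)

(* Defs.v *)
From HB Require Import structures.
From mathcomp Require Import all_boot all_order all_algebra.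
From mathcomp Require Import all_classical all_reals all_analysis.

Set Implicit Arguments.
Unset Strict Implicit.
Unset Printing Implicit Defensive.

Import Order.TTheory GRing.Theory Num.Theory.
Import numFieldNormedType.Exports.

Local Open Scope ring_scope.

(* A digraph on V is given by its arc relation, [arc x y] being an arc from x
   to y. The case [x = y] excludes loops. *)
Definition oriented (V : finType) (arc : rel V) : Prop :=
  forall x y : V, arc x y -> ~~ arc y x.

Definition underlying (V : finType) (arc : rel V) : rel V :=
  [rel x y | arc x y || arc y x].

(* Below, [e : rel V] is the adjacency relation of an undirected simple graph,
   i.e., it is symmetric and irreflexive. *)

Definition induced (V : finType) (e : rel V) (S : {set V}) : rel V :=
  [rel x y | [&& x \in S, y \in S & e x y]].

Definition linked (V : finType) (e : rel V) (S : {set V}) : Prop :=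
  forall x y : V, x \in S -> y \in S -> connect (induced e S) x y.

(* The null graph does not count as connected. *)
Definition connected_set (V : finType) (e : rel V) (S : {set V}) : Prop :=
  (exists x : V, x \in S) /\ linked e S.

(* [linked] rather than [connected_set]: in the one-vertex graph the vertex is
   not a cut-vertex. *)
Definition cut_vertex (V : finType) (e : rel V) (v : V) : Prop :=
  ~ linked e (~: [set v])%SET.

Definition two_vertex_connected (V : finType) (e : rel V) : Prop :=
  connected_set e [set: V]%SET /\ forall v : V, ~ cut_vertex e v.

Definition subcubic (V : finType) (e : rel V) : Prop :=
  forall v : V, (#|e v| <= 3)%N.

Definition bipartite (V : finType) (e : rel V) : Prop :=
  exists X : {set V}, forall x y : V, e x y -> (x \in X) != (y \in X).

Definition independent (V : finType) (e : rel V) (S : {set V}) : Prop :=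
  forall x y : V, x \in S -> y \in S -> ~~ e x y.

Definition acyclic_set (V : finType) (arc : rel V) (S : {set V}) : Prop :=
  forall c : seq V, ucycle arc c -> {subset c <= S} -> c = [::].

Definition CAI_partition (V : finType) (arc : rel V) (A I : {set V}) : Prop :=
  [/\ (A :|: I)%SET = [set: V]%SET,
      [disjoint A & I],
      connected_set (underlying arc) A,
      acyclic_set arc A &
      independent (underlying arc) I].

Local Open Scope classical_set_scope.

(* C is a simple curve in the plane with endpoints p and q. *)
Definition plane_arc (R : realType) (C : set (R * R)) (p q : R * R) : Prop :=
  exists g : R -> R * R,
    [/\ {within `[0, 1], continuous g},
        {in `[0, 1] &, injective g},
        g 0 = p, g 1 = q & g @` `[0, 1] = C].

(* A drawing in the plane R x R: vertices are distinct points, edges are simple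
   curves between their ends, and the interior of an edge contains no vertex
   and no point of any other edge. [draw x y] and [draw y x] are the same set,
   so that an undirected edge is drawn once; [draw] is irrelevant on
   non-edges. *)
Definition planar_drawing (R : realType) (V : finType) (e : rel V)
    (pos : V -> R * R) (draw : V -> V -> set (R * R)) : Prop :=
  let inner x y := draw x y `\` [set pos x; pos y] in
  [/\ injective pos,
      forall x y : V, e x y ->
        draw x y = draw y x /\ plane_arc (draw x y) (pos x) (pos y),
      forall x y z : V, e x y -> ~ inner x y (pos z) &
      forall x y u v : V, e x y -> e u v ->
        ~ (x = u /\ y = v) -> ~ (x = v /\ y = u) ->
        inner x y `&` draw u v = set0].

Definition planar (R : realType) (V : finType) (e : rel V) : Prop :=
  exists (pos : V -> R * R) (draw : V -> V -> set (R * R)),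
    planar_drawing e pos draw.

(* Main.v *)
Require Import Defs.
From mathcomp Require Import all_boot.
From mathcomp Require Import boolp reals.

Set Implicit Arguments.
Unset Strict Implicit.
Unset Printing Implicit Defensive.

(** Let J range over the independent sets whose complement A = ~: J is nonempty
    and connected. Give a vertex v the weight deg v + 1, and let J be optimal
    when its total weight is maximal. If some optimal J leaves A without
    directed cycles then (A, J) is the desired partition; suppose that none
    does.

    Optimality isolates the cycles of A. A vertex of A without a neighbour in J
    must separate A, since otherwise it could join J ([optimal_cut]). Hence, for
    every cycle C of A, deleting the edges of C cuts A into |C| pieces, one
    hanging at each vertex of C ([gate_inj], [gate_ex]); that vertex is the gate
    of its piece. In particular, two cycles of A are equal or disjoint
    ([cyc_eq]). Moreover, if w in J has neighbours (legs) in the piece of y and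
    in another piece, then y may replace w in J: removing y cuts off its piece,
    but w reattaches it ([swap_optimal]).

    Now take J optimal with as few vertices as possible on directed cycles of A,
    single out one of these cycles, S, and let P be the union of the others. A
    state is an optimal set whose directed cycles cover exactly P and one more
    directed cycle. By minimality of J, a swap destroying the cycle of a state
    creates another directed cycle through w ([swap_dcyc]), and so yields a
    new state. This is where the directions come in: a vertex of J cannot have
    legs with three different gates, as each two of them would have to be the
    entry and the exit of a directed cycle ([no_three_gates]). Given two states
    with different cycles, a swap always moves the first set towards the
    second ([exchange]).

    The cycles of two states are equal or disjoint ([states_disjoint]). In a
    violating pair with largest intersection, the swaps leading from one state
    to the other replace the vertices of a set of some size m one by one. So the
    successive states are a fixed part plus the windows of length m of a
    sequence of vertices. Maximality of the intersection forces the next swap,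
    and the sequence can be prolonged for ever ([chain_stream]). But the cycles
    of such a sequence are arranged around each other in a manner that
    contradicts the structure of the pieces ([no_chain]).

    Finally, for a set I of vertices consider the family of the cycles of all
    states containing I. Comparing weights with the size f of the family picks
    a smallest tight I, for which all legs of each w in I have the same gate in
    every state containing I ([tight_uncrossed]). Let U be the union of the
    family, and call the components of the complement of U hubs. Then the state
    J has no vertex outside I other than one on each cycle of the family except
    S ([card_JU], [J_cases]), and the legs of w in I all lie in one hub. So,
    if the f cycles and the hubs are contracted, the edges inside A become a
    forest ([free_darts_le]). Now count the edges that remain by their
    ends. As the cycles have length at least 4 and carry one outgoing edge at
    each vertex, and as each hub has two edges, being attached by no cut-vertex,
    there are at least 4 f + 2 h edge ends, where h is the number of hubs. On
    the other hand, there are at most f - 1 edges at J and at most f + h - 1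
    other edges, which makes at most 4 f + 2 h - 4 ends ([tight_contra]). *)

(** * Connectivity inside vertex sets *)

Lemma connect_closed_in (T : finType) (r : rel T) (K : pred T) (x y : T) :
  (forall u v, r u v -> K u -> K v) -> K x -> connect r x y -> K y.
Proof.
move=> clK Kx /connectP[p + ->]; elim: p x Kx => //= z p IHp x Kx /andP[rxz].
by apply: IHp; apply: clK rxz Kx.
Qed.

Section Undirected.

Variables (V : finType) (e : rel V).
Hypotheses (e_sym : symmetric e) (e_irr : irreflexive e).
Hypothesis e_cubic : subcubic e.

Implicit Types (A B J C Z K : {set V}) (x y z g w : V) (s t : seq V).

Local Notation conn A := (connect (induced e A)).

Lemma inducedE A x y : induced e A x y = [&& x \in A, y \in A & e x y].
Proof. by []. Qed.

Lemma induced_sym A : symmetric (induced e A).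
Proof. by move=> x y; rewrite !inducedE e_sym andbCA. Qed.

Lemma conn_sym A : connect_sym (induced e A).
Proof. exact/sym_connect_sym/induced_sym. Qed.

Lemma conn_sub A B x y : A \subset B -> conn A x y -> conn B x y.
Proof.
move=> /subsetP sAB; apply: connect_sub => u v /and3P[Au Av euv].
by apply: connect1; rewrite inducedE !sAB.
Qed.

Lemma conn1 A x y : x \in A -> y \in A -> e x y -> conn A x y.
Proof. by move=> Ax Ay exy; apply: connect1; rewrite inducedE Ax Ay. Qed.

Lemma conn_path A x s y :
  path e x s -> {subset x :: s <= A} -> y \in x :: s -> conn A x y.
Proof.
elim: s x y => [|z s IHs] x y /=.
  by move=> _ _; rewrite inE => /eqP ->; apply: connect0.
move=> /andP[exz pzs] sA; rewrite inE => /predU1P[-> | zsy].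
  exact: connect0.
have sA' : {subset z :: s <= A} by move=> u u_s; rewrite sA // inE u_s orbT.
apply: connect_trans (IHs z y pzs sA' zsy).
by apply: conn1; rewrite ?sA ?mem_head // inE mem_head orbT.
Qed.

Lemma conn_simple_path A x y : x \in A -> conn A x y ->
  exists s, [/\ path e x s, uniq (x :: s), {subset x :: s <= A} & last x s = y].
Proof.
move=> Ax /connectP[s0 p0 ->]; case/shortenP: p0 => s ps us _.
exists s; split=> //; first by apply: sub_path ps => u v /and3P[].
elim: s x ps {us} Ax => [|z s IHs] x /=.
  by move=> _ Ax u; rewrite inE => /eqP->.
case/andP=> /and3P[_ Az _] pzs Ax u; rewrite inE => /predU1P[->//|].
exact: IHs.
Qed.

Definition ucyc Z : Prop :=
  exists s, [/\ ucycle e s, 2 < size s & Z = [set x in s]].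

Lemma ucyc_at Z x : ucyc Z -> x \in Z ->
  exists y t, [/\ e x y, path e y t, e (last y t) x, t != [::]
    & uniq (x :: y :: t) /\ Z = [set z in x :: y :: t]].
Proof.
case=> s [/andP[cs us] s_gt2 ->]; rewrite inE => xs.
have [i s' def_s] := rot_to xs.
have cs' : cycle e (x :: s') by rewrite -def_s rot_cycle.
have us' : uniq (x :: s') by rewrite -def_s rot_uniq.
have szs' : 2 < size (x :: s') by rewrite -def_s size_rot.
case: s' => [|y t] // in def_s cs' us' szs' *.
move: cs'; rewrite /= rcons_path => /and3P[exy pyt ely].
exists y, t; split=> //; first by case: (t) szs'.
by split=> //; apply/setP => z; rewrite !inE -[in LHS](mem_rot i) def_s !inE.
Qed.

Lemma ucyc_nbrs Z x : ucyc Z -> x \in Z ->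
  exists p q, [/\ p \in Z, q \in Z, p != q, e x p & e x q].
Proof.
move=> cZ xZ; have [y [t [exy pyt elx t0 [ut ->]]]] := ucyc_at cZ xZ.
exists y, (last y t); rewrite !inE eqxx orbT exy e_sym elx; split=> //.
  by rewrite -[_ || (_ \in t)]in_cons mem_last orbT.
case: t ut t0 {pyt elx} => //= z t /and3P[_ + _] _.
by apply: contra => /eqP ->; exact: mem_last.
Qed.

Lemma ucyc_conn_del Z g x y :
  ucyc Z -> x \in Z -> y \in Z -> x != g -> y != g -> conn (Z :\ g) x y.
Proof.
move=> cZ xZ yZ xg yg.
have [gZ | gZ] := boolP (g \in Z).
  have [z [t [_ pzt _ _ [/andP[gt _] dZ]]]] := ucyc_at cZ gZ.
  have sub : {subset z :: t <= Z :\ g}.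
    move=> u ut; rewrite in_setD1 dZ inE in_cons ut orbT andbT.
    by apply: contraNneq gt => <-.
  have zx : x \in z :: t by move: xZ; rewrite dZ !inE (negPf xg).
  have zy : y \in z :: t by move: yZ; rewrite dZ !inE (negPf yg).
  apply: connect_trans (conn_path pzt sub zy).
  by rewrite conn_sym; apply: conn_path pzt sub zx.
have [z [t [exz pzt _ _ [_ dZ]]]] := ucyc_at cZ xZ.
apply: (@conn_path _ x (z :: t)) => /=; first by rewrite exz.
  move=> u ut; rewrite !inE; apply/andP; split.
    by apply: contraNneq gZ => <-; rewrite dZ inE.
  by rewrite dZ inE.
by move: yZ; rewrite dZ inE.
Qed.

(** Each component of A minus g is reached through a neighbour of g: leave g for
    the last time on the way to x. *)
Lemma linked_del_nbr A g x : linked e A -> g \in A -> x \in A -> x != g ->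
  exists n, [/\ e g n, n \in A & conn (A :\ g) n x].
Proof.
move=> lA Ag Ax xg.
pose K := [pred z | (z == g) || [exists n, [&& e g n, n \in A & conn (A :\ g) n z]]].
have: K x.
  apply: (connect_closed_in (r := induced e A) (x := g)); last exact: lA.
    move=> u v /and3P[Au Av euv]; rewrite /K /= => Ku.
    have [// | vg /=] := eqVneq v g.
    case/orP: Ku => [/eqP ug | /existsP[n /and3P[egn An gnu]]].
      by apply/existsP; exists v; rewrite -ug euv Av connect0.
    have [ug | ug] := eqVneq u g.
      by apply/existsP; exists v; rewrite -ug euv Av connect0.
    apply/existsP; exists n; rewrite egn An /=.
    by apply: connect_trans gnu (conn1 _ _ euv); rewrite !inE ?ug ?vg.
  by rewrite /= eqxx.
by rewrite /= (negPf xg) => /existsP[n /and3P[egn An cn]]; exists n.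
Qed.

(** * Optimal sets and the cycles they leave *)

Definition weight J := \sum_(v in J) (#|e v|).+1.

Definition admissible J : Prop :=
  [/\ independent e J, linked e (~: J) & exists x, x \notin J].

Definition optimal J : Prop :=
  admissible J /\ forall J', admissible J' -> weight J' <= weight J.

Lemma weightU1 g J : g \notin J -> weight (g |: J) = (#|e g|).+1 + weight J.
Proof. by move=> gJ; rewrite /weight big_setU1. Qed.

Lemma weightD1 g J : g \in J -> weight J = (#|e g|).+1 + weight (J :\ g).
Proof. by move=> gJ; rewrite /weight (big_setD1 g). Qed.

(** Otherwise g can be added to J. Its neighbours n witness that the complement
    remains nonempty, and by [linked_del_nbr] it is connected as soon as they
    are connected to each other. *)
Lemma optimal_cut J g n : optimal J -> g \notin J ->
  (forall x, e g x -> x \notin J) -> e g n ->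
  (forall x y, e g x -> e g y -> conn (~: J :\ g) x y) -> False.
Proof.
move=> [[iJ lJ _] maxJ] gJ gN egn cg.
have Ag : g \in ~: J by rewrite inE.
suff: admissible (g |: J).
  by move/maxJ; rewrite weightU1 // addSn ltnNge leq_addl.
have dE : ~: (g |: J) = ~: J :\ g by rewrite setCU setDE setIC.
split.
- move=> x y; rewrite !inE => /predU1P[-> | xJ] /predU1P[-> | yJ].
  + by rewrite e_irr.
  + by apply/negP => /gN; rewrite yJ.
  + by rewrite e_sym; apply/negP => /gN; rewrite xJ.
  + exact: iJ.
- rewrite dE => x y; rewrite !in_setD1 => /andP[xg Ax] /andP[yg Ay].
  have [a [ega _ cax]] := linked_del_nbr lJ Ag Ax xg.
  have [b [egb _ cby]] := linked_del_nbr lJ Ag Ay yg.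
  apply: connect_trans (connect_trans (cg a b ega egb) cby).
  by rewrite conn_sym.
- exists n; rewrite !inE negb_or gN // andbT.
  by apply: contraTneq egn => ->; rewrite e_irr.
Qed.

(** The edges that remain in the complement of J without those inside C. When C
    is one of its cycles, connectivity along [off], below [gated], describes the
    pieces hanging at the vertices of C. *)
Definition off J C : rel V :=
  [rel x y | [&& x \notin J, y \notin J, e x y & ~~ ((x \in C) && (y \in C))]].

Lemma offE J C x y :
  off J C x y = [&& x \notin J, y \notin J, e x y & ~~ ((x \in C) && (y \in C))].
Proof. by []. Qed.

Local Notation gated J C := (connect (off J C)).

Lemma gated_sym J C : connect_sym (off J C).
Proof.
apply: sym_connect_sym => x y.
by rewrite !offE e_sym andbCA [(y \in C) && _]andbC.
Qed.

Section Cycle.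

Variables (J C : {set V}).
Hypotheses (oJ : optimal J) (cC : ucyc C) (CJ : C \subset ~: J).

Lemma cyc_notin x : x \in C -> x \notin J.
Proof. by move/(subsetP CJ); rewrite inE. Qed.

(** If all neighbours of g were on C, they would be connected along C without g,
    against [optimal_cut]. *)
Lemma third_nbr g : g \in C ->
  exists p q z, [/\ e g =i [:: p; q; z], uniq [:: p; q; z],
                    p \in C /\ q \in C & z \notin C].
Proof.
move=> gC; have [p [q [pC qC pq egp egq]]] := ucyc_nbrs cC gC.
have [/existsP[z /andP[egz zC]] | noz] := boolP [exists z, e g z && (z \notin C)].
  exists p, q, z.
  have u3 : uniq [:: p; q; z].
    rewrite /= !inE negb_or pq /= andbT.
    by apply/andP; split; apply: contraNneq zC => <-.
  split=> //; apply/fsym/subset_cardP.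
    apply/eqP; rewrite eqn_leq (card_uniqP u3) e_cubic andbT.
    rewrite -(card_uniqP u3); apply/subset_leq_card/subsetP => u.
    by rewrite !inE => /or3P[] /eqP ->.
  apply/subsetP => u.
  by rewrite !inE => /or3P[] /eqP ->.
exfalso; have allC x : e g x -> x \in C.
  move=> egx; apply: contraNT noz => xC; apply/existsP; exists x.
  by rewrite egx.
apply: (optimal_cut oJ (cyc_notin gC) _ egp) => [x /allC/cyc_notin // | x y egx egy].
apply: (@conn_sub (C :\ g)); first exact: setSD.
have neq u : e g u -> u != g by apply: contraTneq => ->; rewrite e_irr.
by apply: ucyc_conn_del; rewrite ?allC ?neq.
Qed.

Lemma cyc_deg g : g \in C -> #|e g| = 3.
Proof.
move/third_nbr => [p [q [z [eg u3 _ _]]]].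
by rewrite (eq_card eg) (card_uniqP u3).
Qed.

(** A connection between g and h off the cycle starts at the third neighbour z
    of g, so that it connects z to h, and so to C, without g. Thus the three
    neighbours of g are connected without g, against [optimal_cut]. *)
Lemma gate_inj g h : g \in C -> h \in C -> gated J C g h -> g = h.
Proof.
move=> gC hC gh; apply/eqP; apply: contraT => g_h; exfalso.
have [p [q [z [eg u3 [pC qC] zC]]]] := third_nbr gC.
have [zJ | zJ] := boolP (z \in J).
  have: [pred x | x == g] h.
    apply: (connect_closed_in _ _ gh) => [u v | ]; last exact: eqxx.
    case/and4P=> _ vJ euv nCC /eqP ug; rewrite ug gC /= in euv nCC.
    have: v \in [:: p; q; z] by rewrite -eg.
    by rewrite !inE => /or3P[] /eqP dv; move: nCC vJ; rewrite dv ?pC ?qC ?zJ.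
  by rewrite /= eq_sym (negPf g_h).
have czh : conn (~: J :\ g) z h.
  have: [pred x | (x == g) || conn (~: J :\ g) z x] h.
    apply: (connect_closed_in _ _ gh) => [u v | /=]; last by rewrite eqxx.
    case/and4P=> uJ vJ euv nCC /= Ku; have [// | vg /=] := eqVneq v g.
    have [ug | ug] := eqVneq u g.
      rewrite ug gC /= in euv nCC.
      have: v \in [:: p; q; z] by rewrite -eg.
      by rewrite !inE => /or3P[] /eqP dv; move: nCC; rewrite dv ?pC ?qC.
    rewrite (negPf ug) /= in Ku.
    by apply: connect_trans Ku (conn1 _ _ euv); rewrite !inE ?ug ?vg.
  by rewrite /= eq_sym (negPf g_h).
have neq u : e g u -> u != g by apply: contraTneq => ->; rewrite e_irr.
have cC' u v : u \in C -> v \in C -> u != g -> v != g -> conn (~: J :\ g) u v.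
  move=> uC vC ug vg; apply: (@conn_sub (C :\ g)); first exact: setSD.
  exact: ucyc_conn_del.
have hg : h != g by rewrite eq_sym.
have toh u : e g u -> conn (~: J :\ g) u h.
  move=> egu; have: u \in [:: p; q; z] by rewrite -eg.
  by rewrite !inE => /or3P[] /eqP du; subst u; rewrite ?czh //; apply: cC' => //; apply: neq.
have egp : e g p by have := eg p; rewrite !inE eqxx => /idP.
apply: (optimal_cut oJ (cyc_notin gC) _ egp) => [x egx | x y egx egy].
  have: x \in [:: p; q; z] by rewrite -eg.
  by rewrite !inE => /or3P[] /eqP -> //; apply: cyc_notin.
by apply: connect_trans (toh x egx) _; rewrite conn_sym toh.
Qed.

Lemma gate_ex x : x \notin J -> exists2 g, g \in C & gated J C x g.
Proof.
move=> xJ; have [c cC0] : exists c, c \in C.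
  case: cC => s [_ + ->]; case: s => // c s _.
  by exists c; rewrite inE mem_head.
have: [pred y | [exists g, (g \in C) && gated J C y g]] x.
  apply: (connect_closed_in (r := induced e (~: J)) (x := c)).
  - move=> u v; rewrite inducedE !inE => /and3P[uJ vJ euv] /existsP[g /andP[gC ug]].
    have [/andP[uC vC] | nCC] := boolP ((u \in C) && (v \in C)).
      by apply/existsP; exists v; rewrite vC connect0.
    apply/existsP; exists g; rewrite gC /=; apply: connect_trans ug.
    by rewrite gated_sym; apply: connect1; rewrite offE uJ vJ euv.
  - by apply/existsP; exists c; rewrite cC0 connect0.
  - by case: oJ => -[_ lJ _] _; apply: lJ; rewrite inE //; apply: cyc_notin.
by case/existsP=> g /andP[gC xg]; exists g.
Qed.

(** The piece hanging at g can be left only through g. *)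
Lemma gate_sep g x y : g \in C -> gated J C x g -> conn (~: J :\ g) x y ->
  gated J C y g.
Proof.
move=> gC xg; apply: (connect_closed_in (K := [pred u | gated J C u g]) _ xg) => u v.
rewrite inducedE !inE => /and3P[/andP[ug uJ] /andP[vg vJ] euv] cug.
apply: connect_trans (cug); rewrite gated_sym; apply: connect1.
rewrite offE uJ vJ euv /=; apply/negP => /andP[uC _].
by rewrite (gate_inj uC gC cug) eqxx in ug.
Qed.

(** Two cycles sharing a vertex of degree 3 share an edge at it. *)
Lemma cycles_meet_twice Z g : ucyc Z -> g \in C -> g \in Z ->
  exists2 d, d \in Z :&: C & d != g.
Proof.
move=> cZ gC gZ; have [p [q [z [eg u3 [pC qC] zC]]]] := third_nbr gC.
have [a [b [aZ bZ ab ega egb]]] := ucyc_nbrs cZ gZ.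
have neq u : e g u -> u != g by apply: contraTneq => ->; rewrite e_irr.
have [aC | aC] := boolP (a \in C); first by exists a; rewrite ?inE ?aZ ?neq.
have [bC | bC] := boolP (b \in C); first by exists b; rewrite ?inE ?bZ ?neq.
have isz u : e g u -> u \notin C -> u = z.
  move=> egu; have: u \in [:: p; q; z] by rewrite -eg.
  by rewrite !inE => /or3P[] /eqP -> //; rewrite ?pC ?qC.
by case/eqP: ab; rewrite (isz a) // (isz b).
Qed.

(** A vertex x of Z off C hangs at some gate g; yet Z meets C in a vertex other
    than g, to which x is connected along Z without g. *)
Lemma cyc_sub Z : ucyc Z -> Z \subset ~: J -> ~~ [disjoint Z & C] -> Z \subset C.
Proof.
move=> cZ ZJ; rewrite -setI_eq0 => /set0Pn[c0]; rewrite inE => /andP[c0Z c0C].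
apply/subsetP => x xZ; apply: contraT => xC; exfalso.
have xJ : x \notin J by move/(subsetP ZJ): (xZ); rewrite inE.
have [g gC xg] := gate_ex xJ.
have [c /setIP[cZ' cC'] cg] : exists2 c, c \in Z :&: C & c != g.
  have [c0g | c0g] := eqVneq c0 g; last by exists c0; rewrite // inE c0Z.
  by apply: cycles_meet_twice; rewrite -?c0g.
case/eqP: (cg); apply: gate_inj => //; apply: (gate_sep gC xg).
apply: (@conn_sub (Z :\ g)); first exact: setSD.
apply: ucyc_conn_del => //; by apply: contraNneq xC => ->.
Qed.

(** The cycle w, p, ..., w meets C in some d other than the common gate g of its
    two legs at w. One of the two parts between w and d avoids g, which
    contradicts [gate_sep]. *)
Lemma cyc_thru_legs w p t : w \in J -> path e w (p :: t) -> uniq (w :: p :: t) ->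
  e (last p t) w -> t != [::] -> {subset p :: t <= ~: J} ->
  ~~ [disjoint [set x in w :: p :: t] & C] -> ~ gated J C p (last p t).
Proof.
move=> wJ pwt uwt elw t0 tA; set Z := [set x in _].
rewrite -setI_eq0 => /set0Pn[c0 /setIP[c0Z c0C]] pq.
have cZ : ucyc Z.
  exists (w :: p :: t); split=> //; last by case: (t) t0.
  by rewrite /ucycle uwt andbT; move: pwt; rewrite /= rcons_path elw andbT.
have pA : p \in ~: J by rewrite tA ?mem_head.
have [g gC pg] := gate_ex (x := p) ltac:(by rewrite inE in pA).
have qg : gated J C (last p t) g by apply: connect_trans pg; rewrite gated_sym.
have [d /setIP[dZ dC] dg] : exists2 d, d \in Z :&: C & d != g.
  have [c0g | c0g] := eqVneq c0 g; last by exists c0; rewrite // inE c0Z.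
  by apply: cycles_meet_twice; rewrite -?c0g.
have dt : d \in p :: t.
  move: dZ; rewrite inE inE => /predU1P[dw | //].
  by rewrite -dw in wJ; rewrite (negPf (cyc_notin dC)) in wJ.
move: pwt => /= /andP[_ ppt]; move: uwt => /= /andP[_ upt].
have contra_d : gated J C d g -> False.
  by move=> dg'; case/eqP: dg; apply: gate_inj.
case/splitPl: dt => t1 t2 def_d in ppt upt tA pq qg elw t0 {Z c0Z cZ dZ} *.
have [p1 p2] : path e p t1 /\ path e d t2.
  by move: ppt; rewrite cat_path def_d => /andP.
rewrite last_cat def_d in qg.
have [gt1 | gt1] := boolP (g \in p :: t1).
  have gt2 : g \notin d :: t2.
    rewrite inE eq_sym negb_or dg /=; move: upt; rewrite -/(uniq (p :: t1 ++ t2)) -cat_cons cat_uniq.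
    case/and3P=> _ /hasPn nt _; apply: contraTN gt1 => gt2; exact: nt.
  apply: contra_d; apply: (gate_sep gC qg); rewrite conn_sym.
  apply: (conn_path p2); last exact: mem_last.
  move=> u ut; rewrite in_setD1 tA; first by rewrite andbT; apply: contraNneq gt2 => <-.
  rewrite -cat_cons mem_cat; move: ut; rewrite inE => /predU1P[->|->].
    by rewrite -def_d mem_last.
  by rewrite orbT.
apply: contra_d; apply: (gate_sep gC pg).
apply: (conn_path p1); last by rewrite -def_d mem_last.
move=> u ut; rewrite in_setD1 tA; first by rewrite andbT; apply: contraNneq gt1 => <-.
by rewrite -cat_cons mem_cat ut.
Qed.

End Cycle.

Lemma cyc_eq J C Z : optimal J -> ucyc C -> C \subset ~: J ->
  ucyc Z -> Z \subset ~: J -> ~~ [disjoint Z & C] -> Z = C.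
Proof.
move=> oJ cC CJ cZ ZJ mZ; apply/eqP; rewrite eqEsubset.
rewrite (cyc_sub oJ cC CJ cZ ZJ mZ) (cyc_sub oJ cZ ZJ cC CJ) //.
by rewrite disjoint_sym.
Qed.

End Undirected.

(** * Swapping a vertex of an optimal set with one of a cycle *)

Section Exchange.

Variables (V : finType) (e : rel V).
Hypotheses (e_sym : symmetric e) (e_irr : irreflexive e).
Hypothesis e_cubic : subcubic e.

Implicit Types (A B J C Z K : {set V}) (x y z g w : V) (s t : seq V).

Local Notation conn A := (connect (induced e A)).
Local Notation gated J C := (connect (off e J C)).

Variables (J C : {set V}).
Hypotheses (oJ : optimal e J) (cC : ucyc e C) (CJ : C \subset ~: J).

(** The only edge of g that leaves C goes to w, hence nothing hangs at g. *)
Lemma third_nbrJ g w : g \in C -> w \in J -> e g w ->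
  (forall v, v \in J -> e g v -> v = w) /\ (forall a, gated J C g a -> a = g).
Proof.
move=> gC wJ egw; have [p [q [z [eg u3 [pC qC] zC]]]] := third_nbr e_sym e_irr e_cubic oJ cC CJ gC.
have isz v : v \in J -> e g v -> v = z.
  move=> vJ egv; have: v \in [:: p; q; z] by rewrite -eg.
  by rewrite !inE => /or3P[] /eqP dv //; rewrite dv (negPf (cyc_notin CJ _)) in vJ.
split=> [v vJ egv|a ga]; first by rewrite (isz v) // (isz w).
apply/eqP; change ([pred x | x == g] a).
apply: (connect_closed_in _ _ ga) => [u v | ]; last exact: eqxx.
case/and4P=> _ vJ euv nCC /eqP ug; rewrite ug gC /= in euv nCC.
have: v \in [:: p; q; z] by rewrite -eg.
rewrite !inE => /or3P[] /eqP dv; move: nCC vJ; rewrite dv ?pC ?qC //.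
by rewrite -(isz w) // wJ.
Qed.

(** Deleting y does not touch the pieces hanging at the other vertices of C. *)
Lemma gated_del y g x : y \in C -> g \in C -> g != y -> gated J C x g ->
  conn (~: J :\ y) x g.
Proof.
move=> yC gC gy; rewrite gated_sym // conn_sym // => xg.
suff /andP[] : [pred u | gated J C g u && conn (~: J :\ y) g u] x by [].
apply: (connect_closed_in _ _ xg) => [u v | /=]; last by rewrite !connect0.
move=> ouv /andP[gu cgu] /=.
have gv : gated J C g v by apply: connect_trans gu (connect1 ouv).
case/and4P: ouv => uJ vJ euv _; rewrite gv; apply: connect_trans cgu _.
have ny k : gated J C g k -> k != y.
  move=> gk; apply: contraNneq gy => dk; apply/eqP.
  by rewrite dk in gk; exact: (gate_inj e_sym e_irr e_cubic oJ cC CJ gC yC gk).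
by apply: conn1; rewrite // !inE ?uJ ?vJ ?ny.
Qed.

(** The piece hanging at y is attached by the single edge from y to its third
    neighbour z, so it stays connected without y. *)
Lemma gated_same_del y a x : y \in C -> gated J C a y -> gated J C x y ->
  a != y -> x != y -> a \notin J -> x \notin J -> conn (~: J :\ y) a x.
Proof.
move=> yC ay xy a_y x_y aJ xJ.
have [p [q [z [ey u3 [pC qC] zC]]]] := third_nbr e_sym e_irr e_cubic oJ cC CJ yC.
have toz u : gated J C u y -> u != y -> u \notin J -> conn (~: J :\ y) u z.
  move=> uy u_y uJ; have [[_ lJ _] _] := oJ.
  have [n [eyn nA cnu]] := linked_del_nbr lJ (subsetP CJ y yC) (x := u) ltac:(by rewrite inE) u_y.
  rewrite conn_sym // in cnu.
  have ny := gate_sep e_sym e_irr e_cubic oJ cC CJ yC uy cnu.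
  have: n \in [:: p; q; z] by rewrite -ey.
  have nC : n \notin C.
    apply: contraTN eyn => nC.
    by rewrite (gate_inj e_sym e_irr e_cubic oJ cC CJ nC yC ny) e_irr.
  rewrite !inE => /or3P[] /eqP dn; rewrite dn ?pC ?qC // in nC cnu *.
by apply: connect_trans (toz a _ _ _) _ => //; rewrite conn_sym // toz.
Qed.

Section Swap.

Variables (w y a b : V).
Hypotheses (wJ : w \in J) (yC : y \in C) (ewa : e w a) (ewb : e w b).
Hypotheses (ya : gated J C y a) (yb : ~ gated J C y b).

Let yJ : y \notin J := cyc_notin CJ yC.

Lemma leg_notin v : e w v -> v \notin J.
Proof. by move=> ewv; apply/negP => vJ; case: oJ => -[/(_ w v wJ vJ)]; rewrite ewv. Qed.

(** Deleting y from the complement of J only cuts off the piece hanging at y,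
    which w ties to the rest again through its legs a and b. The set J with y in
    place of w is independent: if y had another neighbour in J then nothing
    would hang at y, so a would be y and w that neighbour. As y has degree 3,
    which is the maximum, maximality of the weight of J gives w the same
    degree. *)
Lemma swap_optimal : optimal e (y |: J :\ w) /\ #|e w| = 3.
Proof.
have wy : w != y by apply: contraNneq yJ => <-.
have b_y : b != y by apply/eqP => dby; apply: yb; rewrite dby connect0.
have yJw : y \notin J :\ w by rewrite !inE negb_and yJ orbT.
have [[iJ lJ _] maxJ] := oJ.
have ind : forall v, v \in J :\ w -> ~~ e y v.
  move=> v; rewrite !inE => /andP[vw vJ]; apply/negP => eyv.
  have [uniqJ stuck] := third_nbrJ yC vJ eyv.
  have eyw : e y w by rewrite -(stuck a ya) e_sym.
  by rewrite (uniqJ w wJ eyw) eqxx in vw.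
have dA : ~: (y |: J :\ w) = w |: (~: J :\ y).
  apply/setP => x; rewrite !inE negb_or negb_and negbK.
  by have [->|] := eqVneq x w; rewrite /= ?wy.
have AS : ~: J :\ y \subset w |: (~: J :\ y) by apply: subsetUr.
have bA : b \in ~: J :\ y by rewrite !inE b_y leg_notin.
have [gb gbC bgb] := gate_ex e_sym oJ cC CJ (leg_notin ewb).
have gb_y : gb != y.
  by apply/eqP => dgb; apply: yb; rewrite gated_sym // -dgb.
have wb : conn (w |: (~: J :\ y)) w b.
  by apply: conn1; rewrite ?setU11 ?(subsetP AS).
have tob x : x \in ~: J :\ y -> conn (w |: (~: J :\ y)) x b.
  move=> /[dup] xA; rewrite !inE => /andP[x_y xJ].
  have [g gC xg] := gate_ex e_sym oJ cC CJ xJ.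
  have [dg | g_y] := eqVneq g y.
    rewrite dg in xg; have [day | a_y] := eqVneq a y.
      have eyw : e y w by rewrite -day e_sym.
      have [_ stuck] := third_nbrJ yC wJ eyw.
      by rewrite (stuck x) ?eqxx // gated_sym in x_y.
    apply: connect_trans wb; apply: (@connect_trans _ _ a).
      apply: (conn_sub AS); apply: gated_same_del => //; last exact: leg_notin.
      by rewrite gated_sym.
    apply: conn1; rewrite ?setU11 ?(subsetP AS) // 1?e_sym //.
    by rewrite !inE a_y leg_notin.
  apply: (conn_sub AS); apply: connect_trans (gated_del yC gC g_y xg) _.
  apply: (@connect_trans _ _ gb); last by rewrite conn_sym // gated_del.
  by apply: conn_sub (ucyc_conn_del e_sym cC gC gbC g_y gb_y); apply: setSD.
have adm : admissible e (y |: J :\ w).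
  split.
  - move=> u v; rewrite !in_setU1 => /predU1P[-> | uJ] /predU1P[-> | vJ].
    + by rewrite e_irr.
    + exact: ind.
    + by rewrite e_sym ind.
    + by apply: iJ; [move: uJ | move: vJ]; rewrite !inE => /andP[].
  - rewrite dA => u v; have tob' z : z \in w |: (~: J :\ y) -> conn (w |: (~: J :\ y)) z b.
      by rewrite in_setU1 => /predU1P[-> | /tob].
    by move=> /tob' ub /tob' vb; apply: connect_trans ub _; rewrite conn_sym.
  - by exists b; move: (subsetP AS b bA); rewrite -dA inE.
have deg_y := cyc_deg e_sym e_irr e_cubic oJ cC CJ yC.
have w3 := e_cubic w.
have := maxJ _ adm; rewrite weightU1 // (weightD1 _ wJ) deg_y leq_add2r ltnS => w3'.
have dw : #|e w| = 3 by apply/eqP; rewrite eqn_leq w3 w3'.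
split=> //; split=> // J' /maxJ; rewrite (weightD1 _ wJ) dw => le.
by rewrite weightU1 // deg_y.
Qed.

End Swap.

End Exchange.

(** * Directed cycles and states *)

Section Directed.

Variables (V : finType) (arc : rel V).
Hypotheses (arc_oriented : oriented arc) (G_cubic : subcubic (underlying arc)).

Implicit Types (A B J C Z K S : {set V}) (x y z g w : V) (s t : seq V).

Local Notation e := (underlying arc).
Local Notation conn A := (connect (induced e A)).
Local Notation gated J C := (connect (off e J C)).

Lemma und_sym : symmetric e.
Proof. by move=> x y; rewrite /underlying /= orbC. Qed.

Lemma arc_irr : irreflexive arc.
Proof. by move=> x; apply/negP => /[dup] /arc_oriented /negP. Qed.

Lemma und_irr : irreflexive e.
Proof. by move=> x; rewrite /underlying /= arc_irr. Qed.

Lemma und_arc x y : arc x y -> e x y.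
Proof. by rewrite /underlying /= => ->. Qed.

Definition dcyc Z : Prop :=
  exists s, [/\ ucycle arc s, s != [::] & Z = [set x in s]].

(** The directed cycle has a third vertex, because there are no opposite
    arcs. *)
Lemma dcyc_at Z w : dcyc Z -> w \in Z ->
  exists p t, [/\ arc w p, path arc p t, arc (last p t) w, t != [::]
    & uniq (w :: p :: t) /\ Z = [set x in w :: p :: t]].
Proof.
case=> s [/andP[cs us] s0 ->]; rewrite inE => ws.
have [i s' def_s] := rot_to ws.
have cs' : cycle arc (w :: s') by rewrite -def_s rot_cycle.
have us' : uniq (w :: s') by rewrite -def_s rot_uniq.
case: s' => [|p t] in def_s cs' us'.
  by move: cs'; rewrite /= arc_irr.
move: cs'; rewrite /= rcons_path => /and3P[awp pt al].
exists p, t; split=> //.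
  by apply/eqP => t0; move: (arc_oriented awp); rewrite t0 /= in al; rewrite al.
by split=> //; apply/setP => z; rewrite !inE -[in LHS](mem_rot i) def_s !inE.
Qed.

Lemma dcyc_ucyc Z : dcyc Z -> ucyc e Z.
Proof.
move=> cZ; have [w wZ] : exists w, w \in Z.
  by case: cZ => -[|w s] [_ // _ ->]; exists w; rewrite inE mem_head.
have [p [t [awp pt al t0 [ut ->]]]] := dcyc_at cZ wZ.
exists (w :: p :: t); split=> //; last by case: (t) t0.
rewrite /ucycle ut andbT; apply: (sub_cycle und_arc).
by rewrite /= rcons_path awp pt al.
Qed.

(** A disjoint union of cycles when J is optimal, by [cyc_eq]. *)
Definition on_dcyc J : {set V} :=
  [set x | `[< exists Z, [/\ dcyc Z, Z \subset ~: J & x \in Z] >]].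

Lemma on_dcycP J x :
  reflect (exists Z, [/\ dcyc Z, Z \subset ~: J & x \in Z]) (x \in on_dcyc J).
Proof. by rewrite inE; apply: asboolP. Qed.

Section States.

Variable P : {set V}.
(* P stands for all but one of the directed cycles left by an optimal set that
   leaves as few vertices as possible on directed cycles. *)
Hypothesis P_min : forall J, optimal e J -> #|P| < #|on_dcyc J|.

Definition state J S : Prop :=
  [/\ optimal e J, dcyc S, S \subset ~: J, [disjoint P & S] & on_dcyc J = P :|: S].

Lemma state_optimal J S : state J S -> optimal e J. Proof. by case. Qed.
Lemma state_dcyc J S : state J S -> dcyc S. Proof. by case. Qed.
Lemma state_ucyc J S : state J S -> ucyc e S.
Proof. by move/state_dcyc/dcyc_ucyc. Qed.
Lemma state_sub J S : state J S -> S \subset ~: J. Proof. by case. Qed.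

(* The structure of an optimal set around its cycles, at the cycle of a state. *)
Definition state_third_nbr J S (sJ : state J S) :=
  third_nbr und_sym und_irr G_cubic (state_optimal sJ) (state_ucyc sJ) (state_sub sJ).
Definition state_gate_inj J S (sJ : state J S) :=
  gate_inj und_sym und_irr G_cubic (state_optimal sJ) (state_ucyc sJ) (state_sub sJ).
Definition state_gate_sep J S (sJ : state J S) :=
  gate_sep und_sym und_irr G_cubic (state_optimal sJ) (state_ucyc sJ) (state_sub sJ).
Definition state_cyc_deg J S (sJ : state J S) :=
  cyc_deg und_sym und_irr G_cubic (state_optimal sJ) (state_ucyc sJ) (state_sub sJ).
Definition state_cyc_thru_legs J S (sJ : state J S) :=
  cyc_thru_legs und_sym und_irr G_cubic (state_optimal sJ) (state_ucyc sJ) (state_sub sJ).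
Definition state_cyc_eq J S Z (sJ : state J S) :=
  cyc_eq (Z := Z) und_sym und_irr G_cubic (state_optimal sJ) (state_ucyc sJ) (state_sub sJ).
Definition state_third_nbrJ J S (sJ : state J S) :=
  third_nbrJ und_sym und_irr G_cubic (state_optimal sJ) (state_ucyc sJ) (state_sub sJ).
Definition state_swap_optimal J S (sJ : state J S) :=
  swap_optimal und_sym und_irr G_cubic (state_optimal sJ) (state_ucyc sJ) (state_sub sJ).
Definition state_gate_ex J S (sJ : state J S) :=
  gate_ex und_sym (state_optimal sJ) (state_ucyc sJ) (state_sub sJ).

Lemma state_notin J S x : state J S -> x \in S -> x \notin J.
Proof. by move/state_sub/subsetP => sub /sub; rewrite inE. Qed.

Lemma state_dcyc_eq J S Z x : state J S -> dcyc Z -> Z \subset ~: J ->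
  x \in Z -> x \notin P -> Z = S.
Proof.
move=> sJ cZ ZJ xZ xP; have [_ _ _ _ dD] := sJ.
have: x \in on_dcyc J by apply/on_dcycP; exists Z.
rewrite dD inE (negPf xP) /= => xS.
apply: (state_cyc_eq sJ (dcyc_ucyc cZ) ZJ).
by apply/pred0Pn; exists x; rewrite /= xZ.
Qed.

Lemma state_other J S x : state J S -> x \in P ->
  exists Z, [/\ dcyc Z, Z \subset ~: J, x \in Z & [disjoint Z & S]].
Proof.
move=> sJ xP; have [_ _ _ dPS dD] := sJ.
have /on_dcycP[Z [cZ ZJ xZ]] : x \in on_dcyc J by rewrite dD inE xP.
exists Z; split=> //; apply: contraT => mZ.
have dZ := state_cyc_eq sJ (dcyc_ucyc cZ) ZJ mZ.
by move: (disjointFr dPS xP); rewrite -dZ xZ.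
Qed.

(** If S were disjoint from J' it would be a directed cycle left by J', and it
    avoids P. *)
Lemma state_meet J S J' S' : state J S -> state J' S' -> S <> S' ->
  exists2 y, y \in S & y \in J'.
Proof.
move=> sJ sJ' SS'; have [/existsP[y /andP[]]|/existsPn noy] :=
  boolP [exists y, (y \in S) && (y \in J')]; first by exists y.
case: SS'; have cS := state_dcyc sJ; have [_ _ _ dPS _] := sJ.
have [x xS] : exists x, x \in S.
  by case: cS => -[|x s] [_ // _ ->]; exists x; rewrite inE mem_head.
apply: (state_dcyc_eq sJ' cS _ xS); last by rewrite (disjointFl dPS xS).
by apply/subsetP => y yS; rewrite inE; move: (noy y); rewrite yS.
Qed.

Section Swap.

Variables (J C : {set V}) (w y a b : V).
Hypotheses (sJ : state J C) (wJ : w \in J) (yC : y \in C) (ewa : e w a) (ewb : e w b).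
Hypotheses (ya : gated J C y a) (yb : ~ gated J C y b).

Local Notation J1 := (y |: J :\ w).

Let opt1 : optimal e J1 /\ #|e w| = 3.
Proof.
by apply: (state_swap_optimal sJ wJ yC ewa ewb ya yb).
Qed.

(** The cycles in P survive the swap while C, which contains y, is destroyed.
    By [P_min] a new directed cycle appears, and it has to use w. By [cyc_eq]
    there is only one such cycle. *)
Lemma swap_dcyc : exists2 Z, state J1 Z & w \in Z.
Proof.
have yJ := state_notin sJ yC.
have thru Z x : dcyc Z -> Z \subset ~: J1 -> x \in Z -> x \notin P -> w \in Z.
  move=> cZ ZJ xZ xP; apply: contraT => wZ.
  have ZC : Z = C.
    apply: (state_dcyc_eq sJ cZ _ xZ xP); apply/subsetP => z zZ.
    move: (subsetP ZJ z zZ); rewrite !inE negb_or negb_and negbK => /andP[_].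
    by case/orP=> // /eqP dz; rewrite -dz zZ in wZ.
  by move: (subsetP ZJ y); rewrite ZC yC !inE eqxx => /(_ isT).
have oldP x : x \in P ->
    exists Z, [/\ dcyc Z, Z \subset ~: J1, x \in Z & w \notin Z].
  move=> xP; have [Z [cZ ZJ xZ dZ]] := state_other sJ xP.
  exists Z; split=> //; last by apply: contraL wJ => /(subsetP ZJ); rewrite inE.
  apply/subsetP => z zZ; rewrite !inE negb_or negb_and.
  move: (subsetP ZJ z zZ); rewrite inE => ->; rewrite orbT andbT.
  by apply: contraTneq zZ => ->; rewrite (disjointFl dZ yC).
have [x xD xP] : exists2 x, x \in on_dcyc J1 & x \notin P.
  have /subsetPn // : ~~ (on_dcyc J1 \subset P).
  by apply: contraL (P_min opt1.1) => /subset_leq_card; rewrite leqNgt.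
have /on_dcycP[Z [cZ ZJ xZ]] := xD; have wZ := thru Z x cZ ZJ xZ xP.
have eqZ Z' x' : dcyc Z' -> Z' \subset ~: J1 -> x' \in Z' -> x' \in Z -> Z' = Z.
  move=> cZ' ZJ' xZ' xZ2.
  apply: (cyc_eq und_sym und_irr G_cubic opt1.1 (dcyc_ucyc cZ) ZJ (dcyc_ucyc cZ') ZJ').
  by apply/pred0Pn; exists x'; rewrite /= xZ'.
exists Z => //; split=> //; first exact: opt1.1.
  rewrite -setI_eq0; apply: contraT => /set0Pn[x' /setIP[xP' xZ']].
  have [Z' [cZ' ZJ' xZ2 wZ']] := oldP x' xP'.
  by move: wZ'; rewrite (eqZ Z' x') ?wZ.
apply/setP => x'; rewrite in_setU; apply/on_dcycP/orP.
  case=> Z' [cZ' ZJ' xZ']; case: (boolP (x' \in P)) => [|xP']; [by left | right].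
  by rewrite -(eqZ Z' w) // (thru Z' x').
case=> [/oldP[Z' [cZ' ZJ' xZ' _]] | xZ']; first by exists Z'.
by exists Z.
Qed.

(** The legs p and [last p t] through which the new cycle leaves w are connected
    along this cycle without w, hence in the old complement without y. *)
Lemma swap_legs Z : state J1 Z -> w \in Z ->
  exists p t, [/\ arc w p, arc (last p t) w, p != last p t,
    conn (~: J :\ y) p (last p t)
  & [/\ path e w (p :: t), uniq (w :: p :: t), t != [::],
        {subset p :: t <= ~: J :\ y} & Z = [set x in w :: p :: t]]].
Proof.
move=> sZ wZ; have [p [t [awp pt al t0 [ut dZ]]]] := dcyc_at (state_dcyc sZ) wZ.
have sub : {subset p :: t <= ~: J :\ y}.
  move=> x xt; have xZ : x \in Z by rewrite dZ inE in_cons xt orbT.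
  have := state_notin sZ xZ; rewrite !inE negb_or negb_and negbK => /andP[-> /=].
  by case/orP=> // /eqP dx; move: ut; rewrite -dx cons_uniq xt.
have pt' : path e p t by apply: sub_path pt; apply: und_arc.
exists p, t; split=> //.
- case: t ut t0 {pt al dZ sub pt'} => //= z t /and3P[_ + _] _.
  by apply: contra => /eqP ->; exact: mem_last.
- exact: (conn_path pt' sub (mem_last _ _)).
- by split=> //=; rewrite und_arc.
Qed.

End Swap.

(** Swap w with the gate y of a. Leg a is separated by y from the two others, so
    the directed cycle through w that appears uses b and c, one as its entry and
    the other as its exit. *)
Lemma legs_opposite J C w a b c : state J C -> w \in J -> e w a -> e w b -> e w c ->
  ~ gated J C a b -> ~ gated J C a c -> ~ gated J C b c -> arc w b != arc w c.
Proof.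
move=> sJ wJ ewa ewb ewc ab ac bc.
have aJ : a \notin J by apply: (leg_notin (state_optimal sJ) wJ ewa).
have [y yC ay] := state_gate_ex sJ aJ.
have ya : gated J C y a by rewrite gated_sym //; exact: und_sym.
have yb : ~ gated J C y b by move=> yb; apply: ab; apply: connect_trans ay yb.
have [Z sZ wZ] := swap_dcyc sJ wJ yC ewa ewb ya yb.
have [p [t [awp aqw pq cpq _]]] := swap_legs sZ wZ.
have [_ w3] := state_swap_optimal sJ wJ yC ewa ewb ya yb.
have neq u v : ~ gated J C u v -> u != v.
  by move=> uv; apply/eqP => duv; apply: uv; rewrite duv connect0.
have u3 : uniq [:: a; b; c] by rewrite /= !inE negb_or !neq.
have legs u : e w u -> [|| u == a, u == b | u == c].
  move=> ewu; apply: contraT => nu.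
  have u4 : uniq [:: u; a; b; c] by rewrite cons_uniq u3 andbT !inE.
  have: #|[:: u; a; b; c]| <= #|e w|.
    apply/subset_leq_card/subsetP => v; rewrite !inE.
    by case/or4P => /eqP ->.
  by rewrite w3 (card_uniqP u4).
have nsep u v : conn (~: J :\ y) u v -> u = a -> v = b \/ v = c -> False.
  move=> cuv du dv; rewrite du in cuv.
  have := state_gate_sep sJ yC ay cuv.
  move=> vy; have av : gated J C a v.
    by apply: connect_trans ay _; rewrite gated_sym //; exact: und_sym.
  by case: dv => dv; rewrite dv in av.
set q := last p t in aqw pq cpq *.
have cqp : conn (~: J :\ y) q p by rewrite conn_sym //; exact: und_sym.
have ewq : e w q by rewrite und_sym und_arc.
have na : ~~ arc w q by apply: arc_oriented.
case/or3P: (legs p (und_arc awp)) => /eqP dp; case/or3P: (legs q ewq) => /eqP dq.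
- by rewrite dp dq eqxx in pq.
- by case: (nsep p q cpq dp); left.
- by case: (nsep p q cpq dp); right.
- by case: (nsep q p cqp dq); left.
- by rewrite dp dq eqxx in pq.
- by rewrite -dp -dq awp (negPf na).
- by case: (nsep q p cqp dq); right.
- by rewrite -dp -dq awp (negPf na).
- by rewrite dp dq eqxx in pq.
Qed.

(** Two of the three arcs at w have the same direction. *)
Lemma no_three_gates J C w a b c : state J C -> w \in J -> e w a -> e w b -> e w c ->
  ~ gated J C a b -> ~ gated J C a c -> ~ gated J C b c -> False.
Proof.
move=> sJ wJ ewa ewb ewc ab ac bc.
have gs u v : ~ gated J C u v -> ~ gated J C v u.
  by rewrite gated_sym //; exact: und_sym.
have := legs_opposite sJ wJ ewa ewb ewc ab ac bc.
have := legs_opposite sJ wJ ewb ewa ewc (gs _ _ ab) bc ac.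
have := legs_opposite sJ wJ ewc ewa ewb (gs _ _ ac) (gs _ _ bc) ab.
by case: (arc w a); case: (arc w b); case: (arc w c).
Qed.

(** If the legs p and q of the new cycle had different gates, neither gate would
    be y, by [gate_sep], and with a there would be three gates at w. Since they
    have the same gate, the new cycle does not meet C, by [cyc_thru_legs]. *)
Lemma swap_state J C w y a b : state J C -> w \in J -> y \in C -> e w a -> e w b ->
  gated J C y a -> ~ gated J C y b ->
  exists Z, [/\ state (y |: J :\ w) Z, w \in Z, [disjoint Z & C]
    & exists p q, [/\ e w p, e w q, p != q & [/\ p \in Z, q \in Z & gated J C p q]]].
Proof.
move=> sJ wJ yC ewa ewb ya yb.
have [Z sZ wZ] := swap_dcyc sJ wJ yC ewa ewb ya yb.
have [p [t [awp aqw pq cpq [pwt uwt t0 sub dZ]]]] := swap_legs sZ wZ.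
have ewq : e w (last p t) by rewrite und_sym und_arc.
have gs u v : gated J C u v = gated J C v u by rewrite gated_sym //; exact: und_sym.
have gpq : gated J C p (last p t).
  apply: contrapT => npq.
  have sep u v : conn (~: J :\ y) u v -> gated J C u y -> gated J C v y.
    by move=> cuv uy; apply: (state_gate_sep sJ yC uy cuv).
  have npy : ~ gated J C p y.
    move=> py; apply: npq; apply: connect_trans (py) _; rewrite gs.
    exact: sep cpq py.
  have nqy : ~ gated J C (last p t) y.
    by move=> qy; apply: npy; apply: sep qy; rewrite conn_sym //; exact: und_sym.
  apply: (no_three_gates sJ wJ (und_arc awp) ewq ewa npq).
    by move=> pa; apply: npy; apply: connect_trans pa _; rewrite gs.
  by move=> qa; apply: nqy; apply: connect_trans qa _; rewrite gs.
exists Z; split=> //.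
  apply: contraT => mZ.
  have subJ : {subset p :: t <= ~: J} by move=> u /sub; rewrite !inE => /andP[].
  have elw : e (last p t) w by rewrite und_sym.
  rewrite dZ in mZ.
  by have := state_cyc_thru_legs sJ wJ pwt uwt elw t0 subJ mZ.
exists p, (last p t); split=> //; first exact: und_arc.
by split=> //; rewrite dZ !inE ?eqxx ?orbT // -in_cons mem_last !orbT.
Qed.

(** Pick y in S and J' by [state_meet]. In the complement of J', which is
    connected and does not contain y, go from the third neighbour o of y, which
    hangs at y unless it is in J, to its neighbour p on S, which does not. The path leaves the
    piece hanging at y without passing through y, so it does so through a vertex
    w of J, whose legs before and after it allow the swap of w with y. *)
Lemma exchange J S J' S' : state J S -> state J' S' -> S <> S' ->
  exists y w S1, [/\ y \in S, y \in J', w \in J, w \notin J'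
    & [/\ state (y |: J :\ w) S1, w \in S1 & [disjoint S1 & S]]].
Proof.
move=> sJ sJ' SS'; have [y yS yJ'] := state_meet sJ sJ' SS'.
have yJ := state_notin sJ yS.
have gs u v : gated J S u v = gated J S v u by rewrite gated_sym //; exact: und_sym.
have [[iJ _ _] _] := state_optimal sJ; have [[iJ' lJ' _] _] := state_optimal sJ'.
suff [w [a [b [wJ wJ' [ewa ewb] ya yb]]]] : exists w a b,
    [/\ w \in J, w \notin J', e w a /\ e w b, gated J S y a & ~ gated J S y b].
  have [Z [sZ wZ dZ _]] := swap_state sJ wJ yS ewa ewb ya yb.
  by exists y, w, Z.
apply: contrapT => noswap.
have [p [q [o [ey u3 [pS qS] oS]]]] := state_third_nbr sJ yS.
have nJ' u : e y u -> u \notin J' by move=> eyu; apply/negP => /(iJ' y u yJ'); rewrite eyu.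
have eyp : e y p by have := ey p; rewrite !inE eqxx.
have eyo : e y o by have := ey o; rewrite !inE eqxx !orbT.
(* Belonging to the piece hanging at y, or touching it in the case of a vertex
   of J. *)
pose inside := [pred x | if x \in J then [exists v, e x v && gated J S y v]
                         else gated J S y x].
have: inside p.
  apply: (connect_closed_in (r := induced e (~: J')) (x := o)).
  - move=> u v; rewrite inducedE !inE => /and3P[uJ' vJ' euv] /=.
    case: (boolP (u \in J)) => uJ.
      case/existsP=> a /andP[eua ya].
      have vJ : v \notin J by apply/negP => /(iJ u v uJ); rewrite euv.
      rewrite (negPf vJ); apply: contrapT => yv.
      by apply: noswap; exists u, a, v.
    move=> yu; case: (boolP (v \in J)) => vJ.
      by apply/existsP; exists u; rewrite und_sym euv.
    apply: connect_trans (yu) _; apply: connect1; rewrite offE uJ vJ euv /=.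
    apply/negP => /andP[uS _].
    have := state_gate_inj sJ yS uS yu.
    by move=> dy; rewrite -dy yJ' in uJ'.
  - rewrite /=; case: ifP => oJ.
      by apply/existsP; exists y; rewrite und_sym eyo connect0.
    by apply: connect1; rewrite offE yJ oJ eyo (negPf oS) andbF.
  - by apply: lJ'; rewrite inE nJ'.
rewrite /= (negPf (state_notin sJ pS)) => yp.
have := state_gate_inj sJ yS pS yp.
by move=> dy; rewrite -dy und_irr in eyp.
Qed.

End States.
End Directed.

(** * The cycles of two states are equal or disjoint *)

Section Disjoint.

Variables (V : finType) (arc : rel V).
Hypotheses (arc_oriented : oriented arc) (G_cubic : subcubic (underlying arc)).
Variable P : {set V}.
Hypothesis P_min :
  forall J, optimal (underlying arc) J -> #|P| < #|on_dcyc arc J|.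

Implicit Types (J S R Z : {set V}) (u : nat -> V) (x y z w : V).

Local Notation e := (underlying arc).
Local Notation conn A := (connect (induced e A)).
Local Notation gated J C := (connect (off e J C)).
Local Notation state := (state arc P).

Let e_sym := @und_sym V arc.
Let e_irr := und_irr arc_oriented.

(** The cycle of a state is determined by its set ([state_cyc]). *)
Definition cyc J : {set V} := on_dcyc arc J :\: P.

Lemma state_cyc J S : state J S -> S = cyc J.
Proof.
case=> _ _ _ dPS dD; rewrite /cyc dD setDUl setDv set0U.
by apply/setP => x; rewrite inE andbC; case: (boolP (x \in S)) => //= xS; rewrite (disjointFl dPS).
Qed.

Definition is_state J : Prop := state J (cyc J).

Lemma stateP J S : state J S -> is_state J.
Proof. by move=> sJ; rewrite /is_state -(state_cyc sJ). Qed.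

Section Windows.

Variables (R : {set V}) (m : nat).
(* R is what remains common to all the sets of a sequence of swaps; states that
   share more than R are assumed to behave. *)
Hypothesis good : forall J J', is_state J -> is_state J' -> #|R| < #|J :&: J'| ->
  cyc J = cyc J' \/ [disjoint cyc J & cyc J'].

Definition window u i : {set V} := R :|: [set x | [exists k : 'I_m, x == u (i + k)]].

Lemma windowP u i x :
  reflect (x \in R \/ exists k, [/\ i <= k, k < i + m & x = u k]) (x \in window u i).
Proof.
apply: (iffP setUP) => -[xR | ]; try by left.
  rewrite inE => /existsP[k /eqP ->]; right; exists (i + k).
  by rewrite leq_addr ltn_add2l.
case=> k [ik kim ->]; right; rewrite inE; apply/existsP.
have km : k - i < m by rewrite ltn_subLR.
by exists (Ordinal km); rewrite /= subnKC.
Qed.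

Lemma windowR u i x : x \in R -> x \in window u i.
Proof. by move=> xR; apply/windowP; left. Qed.

Lemma window_u u i k : i <= k -> k < i + m -> u k \in window u i.
Proof. by move=> ik kim; apply/windowP; right; exists k. Qed.

Lemma eq_window u v i j : (forall k, k < m -> u (i + k) = v (j + k)) -> window u i = window v j.
Proof.
move=> uv; apply/setP => x; rewrite !inE; congr (_ || _).
by apply: eq_existsb => k; rewrite uv.
Qed.

Lemma overlap J J' x : R \subset J -> R \subset J' -> x \in J -> x \in J' ->
  x \notin R -> #|R| < #|J :&: J'|.
Proof.
move=> RJ RJ' xJ xJ' xR; apply/proper_card/properP; split.
  by rewrite subsetI RJ.
by exists x; rewrite // inE xJ.
Qed.

Definition bad J J' := cyc J <> cyc J' /\ ~~ [disjoint cyc J & cyc J'].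

(** The sequence of swaps from a state to another one with a bad pair of cycles:
    the i-th swap puts [u (i + m)], taken from the cycle of the i-th window, in
    place of [u i], which lies on the cycle of the next window. Only the
    values of u below m + m matter. *)
Definition chain u : Prop :=
  [/\ forall i, i <= m -> is_state (window u i),
      forall i, i < m -> u (i + m) \in cyc (window u i),
      forall i, i < m -> u i \in cyc (window u i.+1)
    & bad (window u 0) (window u m)].

(** The next chain: the first vertex is dropped and d becomes the last one, of
    index m + m - 1. *)
Definition shift u (d : V) k := if k.+1 == m + m then d else u k.+1.

Lemma window_shift u d i : i < m -> window (shift u d) i = window u i.+1.
Proof.
move=> im; apply: eq_window => k km; rewrite /shift.
by rewrite ltn_eqF // -addSn -addnS leq_add.
Qed.

(** What is remembered about the step that adds d: the cycles of the first
    window and of the new one share, besides [u m], a leg l of [u m] whose gate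
    in the last window is d. *)
Definition link u d l : Prop :=
  [/\ l \in cyc (window u 0), l \in cyc (window (shift u d) m), l <> u m
    & gated (window u m) (cyc (window u m)) l d].

(** Let y be [u m] and Sm the cycle of the last window Jm. By [good], S0 is
    disjoint from the cycles between it and Sm, so that y is the only vertex of S0
    in Jm. Since S0 meets Sm, its two edges at y are legs p and q of y with
    different gates on Sm. The third leg o shares a gate with one of them, called
    l, for there are no three gates; k is the other one. Swapping y with the gate
    d of l gives a new state, with a cycle E through y, l and o that does not
    meet Sm. As E meets S0 in y, it is not S0, so it contains a vertex [u j] of
    the first window, and meets the cycle of window j + 1 there. That cycle is not
    Sm, which E avoids, and for j > 0 it would be E by [good], although E meets
    S0. So j is 0, and the shifted chain again ends with a bad pair, the cycle of
    window 1 and E. *)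
Lemma chain_step u : chain u ->
  exists d, [/\ 1 < m, chain (shift u d), u 0 \in cyc (window (shift u d) m)
    & exists l, link u d l].
Proof.
case=> st new old [neq0 meet0].
have [m0 | m_gt0] := posnP m.
  by case: neq0; rewrite m0.
have lt_add i : i < i + m by rewrite -addn1 leq_add2l.
have notwin i x : i <= m -> x \in cyc (window u i) -> x \notin window u i.
  by move=> im; apply: state_notin (st i im).
have RW i : R \subset window u i by apply/subsetP => x; apply: windowR.
have uR k : k < m + m -> u k \notin R.
  move=> k2; have [km | mk] := ltnP k m.
    by apply: contra (windowR u k.+1 (x := _)) (notwin k.+1 _ km (old k km)).
  have km : k - m < m by rewrite ltn_subLR.
  have := new _ km; rewrite subnK // => /(notwin _ _ (ltnW km)).
  by apply: contra; apply: windowR.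
have near i j : i < j -> j <= m -> j < i + m ->
    cyc (window u i) = cyc (window u j) \/ [disjoint cyc (window u i) & cyc (window u j)].
  move=> ij jm jim; apply: good; try apply: st; rewrite ?(leq_trans (ltnW ij)) //.
  apply: (@overlap _ _ (u j)); rewrite ?RW //.
  - by rewrite window_u // ltnW.
  - by rewrite window_u.
  - by rewrite uR // (leq_ltn_trans jm).
have disj0 j : 0 < j -> j < m -> [disjoint cyc (window u 0) & cyc (window u j)].
  move=> j0 jm; case: (near 0 j) => //; first exact: ltnW.
  move=> e0j; case: (near j m) => //; rewrite -?e0j.
  + by rewrite -{1}[m]add0n ltn_add2r.
  + by move=> /neq0.
  + by move=> d0m; rewrite d0m in meet0.
set J0 := window u 0; set Jm := window u m.
set S0 := cyc J0; set Sm := cyc Jm.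
have s0 : state J0 S0 := st 0 (leq0n m); have sm : state Jm Sm := st m (leqnn m).
pose y := u m; have yS0 : y \in S0 by have := new 0 m_gt0; rewrite add0n.
have yJm : y \in Jm by rewrite window_u.
have meet_y x : x \in S0 -> x \in Jm -> x = y.
  move=> xS0 /windowP[xR | [k [mk km2 dx]]].
    by have := notwin 0 x isT xS0; rewrite windowR.
  have [ky | km] := eqVneq k m; first by rewrite dx ky.
  have lkm : k - m < m by rewrite ltn_subLR.
  have gkm : 0 < k - m by rewrite subn_gt0 ltn_neqAle eq_sym km.
  have := new _ lkm; rewrite subnK // -dx => xS.
  by have := disj0 _ gkm lkm; move/disjointFr/(_ xS0); rewrite xS.
have [p [t [ayp pt al t0 [ut dS0]]]] := dcyc_at arc_oriented (state_dcyc s0) yS0.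
set q := last p t in al.
have inS0 x : x \in p :: t -> x \in S0 by move=> xt; rewrite dS0 inE in_cons xt orbT.
have ny x : x \in p :: t -> x != y.
  by move=> xt; apply: contraTneq ut => dx; rewrite cons_uniq -dx xt.
have qt : q \in p :: t := mem_last _ _.
have pt0 : p \in p :: t := mem_head _ _.
have eyp : e y p := und_arc ayp.
have eyq : e y q by rewrite e_sym und_arc.
have npq : ~ gated Jm Sm p q.
  apply: (state_cyc_thru_legs arc_oriented G_cubic sm yJm _ ut) => //.
  - by rewrite /= eyp; apply: sub_path pt; apply: und_arc.
  - exact: und_arc.
  - move=> x xt; rewrite inE; apply: contra (ny x xt) => xJm.
    by apply/eqP; apply: meet_y => //; apply: inS0.
  - by rewrite -dS0.
have gsym a b : gated Jm Sm a b = gated Jm Sm b a by apply: gated_sym.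
have [o legs] : exists o, e y o /\ forall x, e y x -> [|| x == p, x == q | x == o].
  have [a [b [c [ey u3 _ _]]]] := state_third_nbr arc_oriented G_cubic s0 yS0.
  have pq : p != q by apply/eqP => dpq; apply: npq; rewrite dpq connect0.
  have memey x : e y x = (x \in [:: a; b; c]) by rewrite -ey.
  move: eyp eyq; rewrite !memey !inE.
  have [xa [xb xc]] : a \in [:: a; b; c] /\ b \in [:: a; b; c] /\ c \in [:: a; b; c].
    by rewrite !inE !eqxx !orbT.
  case/or3P => /eqP dp; case/or3P => /eqP dq; rewrite dp dq ?eqxx // in pq *.
  - by exists c; rewrite memey; split=> // x; rewrite memey !inE.
  - by exists b; rewrite memey; split=> // x; rewrite memey !inE => /or3P[] ->; rewrite ?orbT.
  - by exists c; rewrite memey; split=> // x; rewrite memey !inE => /or3P[] ->; rewrite ?orbT.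
  - by exists a; rewrite memey; split=> // x; rewrite memey !inE => /or3P[] ->; rewrite ?orbT.
  - by exists b; rewrite memey; split=> // x; rewrite memey !inE => /or3P[] ->; rewrite ?orbT.
  - by exists a; rewrite memey; split=> // x; rewrite memey !inE => /or3P[] ->; rewrite ?orbT.
case: legs => eyo legs.
have [l [k [lt kt [eyl eyk] lo [nlk legs']]]] : exists l k,
    [/\ l \in p :: t, k \in p :: t, e y l /\ e y k, gated Jm Sm l o
      & ~ gated Jm Sm l k /\ forall x, e y x -> [|| x == l, x == k | x == o]].
  have [po | po] := pselect (gated Jm Sm p o); first by exists p, q.
  have [qo | qo] := pselect (gated Jm Sm q o).
    exists q, p; split=> //; split; first by rewrite gsym.
    by move=> x /legs /or3P[] ->; rewrite ?orbT.
  by case: (no_three_gates arc_oriented G_cubic P_min sm yJm eyp eyq eyo).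
have lJm : l \notin Jm.
  by apply: contra (ny l lt) => lJm; apply/eqP; apply: meet_y => //; apply: inS0.
have [d dSm ld] := state_gate_ex arc_oriented sm lJm.
have dl : gated Jm Sm d l by rewrite gsym.
have dk : ~ gated Jm Sm d k by move=> dk; apply: nlk; apply: connect_trans ld dk.
have [E [sE yE dESm [a [b [eya eyb ab [aE bE gab]]]]]] :=
  swap_state arc_oriented G_cubic P_min sm yJm dSm eyl eyk dl dk.
have lE : l \in E.
  case/or3P: (legs' a eya) => /eqP da; case/or3P: (legs' b eyb) => /eqP db;
    rewrite da db ?eqxx // in ab aE bE gab *.
    by case: nlk; rewrite gsym in gab; apply: connect_trans lo gab.
  by case: nlk; apply: connect_trans lo gab.
set v := shift u d.
have vk k' : k'.+1 < m + m -> v k' = u k'.+1 by move=> lt'; rewrite /v /shift ltn_eqF.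
have v2 : v (m + m).-1 = d by rewrite /v /shift prednK ?addn_gt0 ?m_gt0 ?eqxx.
have winv i : i < m -> window v i = window u i.+1 by apply: window_shift.
have winvm : window v m = d |: Jm :\ y.
  apply/setP => x; rewrite in_setU1 in_setD1; apply/windowP/idP.
    case=> [xR | [k' [mk km2 ->]]].
      by rewrite windowR // andbT; apply/orP; right; apply: contraTneq xR => ->; rewrite uR // lt_add.
    have [dk' | ltk] := eqVneq k'.+1 (m + m).
      by rewrite -[k']/(k'.+1.-1) dk' v2 eqxx.
    have ltk' : k'.+1 < m + m by rewrite ltn_neqAle ltk.
    rewrite vk // window_u ?ltnS // 1?leqW // andbT; apply/orP; right.
    have lkm : k'.+1 - m < m by rewrite ltn_subLR // leqW.
    have gkm : 0 < k'.+1 - m by rewrite subn_gt0 ltnS.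
    apply/eqP => duy; have := new _ lkm; rewrite subnK ?leqW // duy => yS.
    by have := disj0 _ gkm lkm; move/disjointFr/(_ yS0); rewrite yS.
  case/predU1P => [-> | /andP[xy /windowP[xR | [k' [mk km2 dx]]]]]; last 2 first.
  - by left.
  - right; case: k' => [|k'] in mk km2 dx *.
      by move: mk; rewrite leqNgt m_gt0.
    have km : m <= k'.
      rewrite -ltnS ltn_neqAle mk andbT; apply: contraNneq xy => dm.
      by rewrite dx -dm.
    by exists k'; rewrite vk // km ltnW.
  right; exists (m + m).-1; rewrite v2 prednK ?addn_gt0 ?m_gt0 //; split=> //.
  by rewrite -ltnS prednK ?addn_gt0 ?m_gt0 // lt_add.
have stm : is_state (window v m) by rewrite winvm; apply: stateP sE.
have cycE : cyc (window v m) = E by rewrite winvm -(state_cyc sE).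
have stv i : i <= m -> is_state (window v i).
  rewrite leq_eqVlt => /predU1P[-> // | im]; rewrite winv //; exact: st.
have ES0 : E <> S0 by move=> dE; move: meet0; rewrite -/J0 -/Jm -/S0 -/Sm -dE dESm.
have RE x : x \in R -> x \notin E.
  by move=> xR; rewrite -cycE; apply: contraTN (windowR v m xR); apply: state_notin stm.
have [x0 x0E /windowP[x0R | [k0 [_ k0m dx0]]]] := state_meet arc_oriented G_cubic sE s0 ES0.
  by rewrite (negPf (RE _ x0R)) in x0E.
rewrite add0n in k0m.
have k00 : k0 = 0 /\ 1 < m.
  have x0S := old k0 k0m; rewrite -dx0 in x0S.
  have [km | km] := eqVneq k0.+1 m.
    by move: x0S; rewrite km -/Sm (disjointFr dESm x0E).
  have k1m : k0.+1 < m by rewrite ltn_neqAle km.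
  case: k0 => [|k0] in k0m dx0 x0S km k1m *; first by split.
  have m1_2 : m.+1 < m + m by rewrite -addn1 ltn_add2l (leq_trans _ k1m).
  have [eqE | dE] : cyc (window u k0.+2) = E \/ [disjoint cyc (window u k0.+2) & E].
    rewrite -cycE -winv; last exact: ltnW.
    apply: good => //; first by apply: stv; rewrite ltnW // ltnW.
    apply: (@overlap _ _ (v m)).
    - by apply/subsetP => x; apply: windowR.
    - by apply/subsetP => x; apply: windowR.
    - by apply: window_u; [rewrite ltnW // ltnW | rewrite addSn ltnS leq_addl].
    - exact: window_u.
    - by rewrite vk ?uR.
  + have := disj0 k0.+2 isT k1m; rewrite eqE => /disjointFr/(_ yS0).
    by rewrite yE.
  + by have := disjointFr dE x0S; rewrite x0E.
have [k0_0 m_gt1] := k00; rewrite k0_0 in dx0 => {k00 k0m}.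
exists d; split=> //; first last.
- by exists l; split; rewrite -/v ?cycE //; [apply: inS0 | apply/eqP; apply: ny].
- by rewrite -/v cycE -dx0.
split=> // [i im | i im | ].
- rewrite -/v winv //; have [im1 | im1] := eqVneq i.+1 m.
    have -> : i + m = (m + m).-1 by rewrite -[X in (X + _).-1]im1.
    by rewrite v2 im1.
  have lim : i.+1 < m by rewrite ltn_neqAle im1.
  by rewrite vk; [apply: new | rewrite -addSn ltn_add2r].
- rewrite -/v; have [im1 | im1] := eqVneq i.+1 m.
    by rewrite im1 cycE vk ?im1 // lt_add.
  have lim : i.+1 < m by rewrite ltn_neqAle im1.
  rewrite winv // vk; first exact: old.
  by rewrite (leq_trans lim) // leq_addr.
- rewrite -/v winv // /bad cycE; split.
    move=> dE; have yW : y \in window u 1 by rewrite window_u // add1n ltnS.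
    by have := notwin 1 y m_gt0; rewrite dE yE yW => /(_ isT).
  apply/pred0Pn; exists (u 0); rewrite /= -{2}dx0 x0E andbT.
  exact: old.
Qed.

(** Iterating [chain_step] and reading the first terms of the successive chains
    gives one infinite sequence all of whose windows are states. *)
Lemma chain_stream u0 : chain u0 -> exists u,
  [/\ 1 < m, forall i, is_state (window u i),
      forall i, u (i + m) \in cyc (window u i) /\ u i \in cyc (window u i.+1),
      forall i, bad (window u i) (window u (i + m))
    & forall i, u i \in cyc (window u (i + m).+1) /\
        exists l, [/\ l \in cyc (window u i), l \in cyc (window u (i + m).+1),
          l <> u (i + m)
        & gated (window u (i + m)) (cyc (window u (i + m))) l (u (i + (m + m)))]].
Proof.
move=> ch0.
have [f fP] : {f : (nat -> V) -> V & forall u, chain u ->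
    [/\ 1 < m, chain (shift u (f u)), u 0 \in cyc (window (shift u (f u)) m)
      & exists l, link u (f u) l]}.
  have ex u : exists d, chain u ->
      [/\ 1 < m, chain (shift u d), u 0 \in cyc (window (shift u d) m)
        & exists l, link u d l].
    have [/chain_step[d fd] | nch] := pselect (chain u); first by exists d.
    by exists (u 0).
  by have [f fP] := choice ex; exists f.
pose G t := iter t (fun u => shift u (f u)) u0.
have GS t : G t.+1 = shift (G t) (f (G t)) by [].
have chG t : chain (G t) by elim: t => [//|t /fP[]].
have m_gt1 : 1 < m by case: (fP _ ch0).
have m_gt0 : 0 < m := ltnW m_gt1.
pose u t := G t 0.
have Gu k t : k < m + m -> G t k = u (t + k).
  elim: k t => [|k IHk] t lt_k; first by rewrite addn0.
  by rewrite addnS -addSn -IHk 1?ltnW // GS /shift ltn_eqF.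
have fG t : f (G t) = u (t + (m + m)).
  have mm : (m + m).-1.+1 = m + m by rewrite prednK // addn_gt0 m_gt0.
  transitivity (G t.+1 (m + m).-1); first by rewrite GS /shift mm eqxx.
  by rewrite Gu ?mm // addSn -addnS mm.
have winG t i : i <= m -> window (G t) i = window u (t + i).
  move=> im; apply: eq_window => k km.
  rewrite Gu ?addnA // -[m in _ < m + _]/m.
  by rewrite -addnS leq_add.
have winG0 t : window (G t) 0 = window u t by rewrite winG // addn0.
have winGm t : window (G t) m = window u (t + m) by rewrite winG.
have lt_mm : m < m + m by rewrite -addn1 leq_add2l.
exists u; split=> // [i | i | i | i].
- by rewrite -winG0; case: (chG i) => /(_ 0 (leq0n m)).
- have [_ /(_ 0 m_gt0) new /(_ 0 m_gt0) old _] := chG i.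
  move: new old; rewrite add0n winG0 Gu // winG // addn1.
  by rewrite [G i 0]/(u i).
- by case: (chG i) => _ _ _; rewrite winG0 winGm.
- have [_ _ + [l]] := fP _ (chG i).
  rewrite /link -GS winGm winG0 winGm addSn => old [l0 lm ly lg].
  by split=> //; exists l; rewrite -fG -Gu.
Qed.

(** Let S i be the cycle of window i. Two cycles at distance less than m are
    disjoint, those at distance m meet, and S (m + i.+1) contains [u i] and
    meets S i.+1 as well. Consider window m, its cycle S m, and the
    vertex d = [u (m + m)] of S m. The cycles S (m + 1), S 1, S (m + 2),
    S 2, ..., S (m + m) avoid S m, except the last one, each meets window m in
    a single vertex, and each meets the next one in another vertex. So all of
    them hang, without that vertex, at the same vertex of S m as the first one
    does, which is d. But the last one meets S m and does not contain d, a
    vertex of its window. *)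
Lemma no_chain u0 : ~ chain u0.
Proof.
case/chain_stream => u [m_gt1 st adj bads links].
have m_gt0 : 0 < m := ltnW m_gt1.
pose S i := cyc (window u i).
have lt_add i : i < i + m by rewrite -addn1 leq_add2l.
have notwin i x : x \in S i -> x \notin window u i by apply: state_notin (st i).
have new i : u (i + m) \in S i by case: (adj i).
have old i : u i \in S i.+1 by case: (adj i).
have uR k : u k \notin R by apply: contra (notwin _ _ (old k)); apply: windowR.
have near i j k : i <= k -> k < i + m -> j <= k -> k < j + m ->
    S i = S j \/ [disjoint S i & S j].
  move=> ik kim jk kjm; apply: good => //; apply: (@overlap _ _ (u k)).
  - by apply/subsetP => x; apply: windowR.
  - by apply/subsetP => x; apply: windowR.
  - exact: window_u.
  - exact: window_u.
  - exact: uR.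
have disj i j : i < j -> j < i + m -> [disjoint S i & S j].
  move=> ij jim; have [] := near i j j => //; first exact: ltnW.
  have [neq meet] := bads i.
  move=> eij; have [] := near j (i + m) (i + m) => //; rewrite -?eij.
  + exact: ltnW.
  + by rewrite ltn_add2r.
  + by move/neq.
  + by move=> d; case/negP: meet.
have disjD i j x : x \in S i -> x \in S j -> i < j + m -> j < i + m -> i = j.
  move=> xi xj ijm jim; case: (ltngtP i j) => // [ij | ji].
    by have := disjointFr (disj i j ij jim) xi; rewrite xj.
  by have := disjointFr (disj j i ji ijm) xj; rewrite xi.
pose d := u (m + m).
pose g := gated (window u m) (S m).
have sm : state (window u m) (S m) := st m.
have dSm : d \in S m := new m.
have only_above i x : 0 < i -> i <= m -> x \in S (m + i) -> x \in window u m -> x = u (m + i).-1.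
  move=> i0 im xS /windowP[xR | [k [mk kmm dx]]].
    by have := notwin _ _ xS; rewrite windowR.
  have [kmi | mik] := ltnP k (m + i); last first.
    have : x \in window u (m + i) by rewrite dx window_u // (leq_trans kmm) // leq_add2r leq_addr.
    by rewrite (negPf (notwin _ _ xS)).
  have xk : x \in S k.+1 by rewrite dx.
  have <- : k.+1 = m + i; last by rewrite dx.
  apply: (disjD _ _ _ xk xS); first exact: leq_ltn_trans kmi (lt_add _).
  by rewrite addSn ltnS leq_add.
have only_below i x : i < m -> x \in S i -> x \in window u m -> x = u (i + m).
  move=> im xS /windowP[xR | [k [mk kmm dx]]].
    by have := notwin _ _ xS; rewrite windowR.
  have xk : x \in S (k - m) by rewrite dx -{1}(subnK mk).
  have km : k - m < m by rewrite ltn_subLR.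
  have <- : k - m = i; last by rewrite subnK.
  by apply: (disjD _ _ _ xk xS); rewrite ltn_addl.
(* A cycle that avoids S m and meets window m only in y hangs at d as soon as
   one of its vertices other than y does. *)
have spread i y : [disjoint S i & S m] -> y \in window u m ->
    (forall x, x \in S i -> x \in window u m -> x = y) ->
  forall a b, a \in S i -> b \in S i -> a <> y -> b <> y -> g a d -> g b d.
  move=> dm yW only a b aS bS ay by_ ad; apply: connect_trans ad.
  have si : ucyc e (S i) := state_ucyc arc_oriented (st i).
  have := ucyc_conn_del e_sym si bS aS; move/(_ y).
  move=> /(_ (introN eqP by_) (introN eqP ay)).
  apply: connect_sub => p q; rewrite inducedE !in_setD1.
  case/and3P => /andP[py pS] /andP[qy qS] epq; apply: connect1; rewrite offE epq.
  rewrite (disjointFr dm pS) !andbT.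
  by apply/andP; split; [apply: contraNN py | apply: contraNN qy] => ?; apply/eqP/only.
(* The piece at d is handed on from S (m + i) to S (m + i.+1) by S i. *)
have step i : i < m -> exists l, [/\ l \in S (m + i.+1), l <> u (m + i) & g l d].
  elim: i => [|i IHi] im.
    have [_ [l [_ lS ly lg]]] := links 0.
    by exists l; rewrite addn0 addn1; move: lS ly lg; rewrite !add0n.
  have [l [lS ly lg]] := IHi (ltnW im).
  have i1m : i < m := ltnW im.
  have neqW j k : j < m -> m <= k -> k < m + m -> u j <> u k.
    move=> jm mk kmm jk; have [neq meet] := bads 0; rewrite add0n in neq meet.
    have : #|R| < #|window u 0 :&: window u m|.
      apply: (@overlap _ _ (u j)); rewrite ?uR //.
      - by apply/subsetP => x; apply: windowR.
      - by apply/subsetP => x; apply: windowR.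
      - by rewrite window_u.
      - by rewrite jk window_u.
    by case/(good (st 0) (st m)) => [/neq | dd] //; rewrite dd in meet.
  have dL : [disjoint S (m + i.+1) & S m].
    by rewrite disjoint_sym; apply: disj; rewrite ?ltn_add2l // -addSnnS leq_addr.
  have ui : g (u i) d.
    have [uS _] := links i; rewrite addnC -addnS in uS.
    apply: (spread _ (u (m + i)) dL _ _ l) => //.
    - by rewrite window_u ?leq_addr // ltn_add2l.
    - by move=> x xS xW; have := only_above i.+1 x; rewrite addnS; apply; rewrite -?addnS.
    - by apply: neqW; rewrite ?leq_addr // ltn_add2l.
  have dR : [disjoint S i.+1 & S m] by apply: disj => //; rewrite addSn ltnS leq_addl.
  have [_ [l' [l'S l'S2 l'y _]]] := links i.+1.
  exists l'; split; first by rewrite addnS addnC.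
    by rewrite addnC.
  apply: (spread _ (u (i.+1 + m)) dR _ _ (u i)) => //.
  - by rewrite window_u ?leq_addl // ltn_add2r.
  - by move=> x; apply: only_below.
  - by apply: neqW; rewrite ?leq_addl // ltn_add2r.
have [l [lS ly lg]] : exists l, [/\ l \in S (m + m), l <> u (m + m).-1 & g l d].
  have [l] := step m.-1 ltac:(by rewrite prednK).
  have -> : m + m.-1 = (m + m).-1 by case: (m) m_gt0 => // k _; rewrite addnS.
  by rewrite prednK // => -[lS ly lg]; exists l.
have [_ /pred0Pn[c /andP[/= cSm cS2]]] := bads m.
have dS2 : d \notin S (m + m).
  by apply: contraL (@window_u u _ _ (leqnn (m + m)) (lt_add _)); apply: notwin.
have dnW : d \notin window u m := notwin m d dSm.
have uW : u (m + m).-1 \in window u m.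
  by apply: window_u; [rewrite -ltnS prednK ?addn_gt0 ?m_gt0 // | rewrite prednK ?addn_gt0 ?m_gt0].
have cd : g c d.
  apply: (state_gate_sep arc_oriented G_cubic sm dSm lg).
  have s2 : ucyc e (S (m + m)) := state_ucyc arc_oriented (st _).
  have cy : c != u (m + m).-1 by apply: contraTneq uW => <-; apply: notwin.
  apply: conn_sub (ucyc_conn_del e_sym s2 lS cS2 (introN eqP ly) cy).
  apply/subsetP => x; rewrite !in_setD1 in_setC => /andP[xy xS]; apply/andP; split.
    by apply/eqP => dx; move/negP: dS2; apply; rewrite -dx.
  by apply: contraNN xy => xW; apply/eqP; apply: only_above.
have dc := state_gate_inj arc_oriented G_cubic sm cSm dSm cd.
by rewrite -dc cS2 in dS2.
Qed.

End Windows.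

(** Swap J towards J' by [exchange] until the cycle of J' is reached, after m
    steps. The vertices w k taken out of J and the vertices y k put in, which
    lie in J', are all different; listed in this order they form the sequence u.
    With R the part of J that is never touched, the k-th set is R together with
    w k, ..., w m.-1, y 0, ..., y k.-1, that is, the k-th window. *)
Lemma bad_chain J J' : is_state J -> is_state J' -> bad J J' ->
  exists R m u, [/\ J :&: J' \subset R & chain R m u].
Proof.
move=> sJ sJ' [neq meet].
pose ok K (yw : V * V) := [&& yw.1 \in cyc K, yw.1 \in J', yw.2 \in K, yw.2 \notin J',
   `[< is_state (yw.1 |: K :\ yw.2) >] & yw.2 \in cyc (yw.1 |: K :\ yw.2)].
have [x0 _] : exists x, x \in cyc J.
  by move: meet => /pred0Pn[x /andP[xJ _]]; exists x.
pose nx K := odflt (x0, x0) [pick yw | ok K yw].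
have nxP K : is_state K -> cyc K <> cyc J' -> ok K (nx K).
  move=> sK neK; rewrite /nx; case: pickP => [yw // | none].
  have [y [w [S1 [yK yJ' wK wJ' [s1 w1 _]]]]] :=
    exchange arc_oriented G_cubic P_min sK sJ' neK.
  have := none (y, w); rewrite /ok /= yK yJ' wK wJ' -(state_cyc s1) w1 andbT /=.
  by move/asboolP; case; apply: stateP s1.
pose q k := iter k (fun K => (nx K).1 |: K :\ (nx K).2) J.
pose y k := (nx (q k)).1; pose w k := (nx (q k)).2.
have qS k : q k.+1 = y k |: q k :\ w k by [].
have stq k : (forall j, j < k -> cyc (q j) <> cyc J') -> is_state (q k).
  elim: k => // k IHk nek; have sk : is_state (q k) by apply: IHk => j /ltnW; apply: nek.
  by have /and5P[_ _ _ _ /andP[/asboolP]] := nxP _ sk (nek k (ltnSn k)).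
have exm : exists k, cyc (q k) == cyc J'.
  apply: contrapT => nok.
  have nek k : cyc (q k) <> cyc J' by move=> ek; apply: nok; exists k; apply/eqP.
  have drop k : #|q k :\: J'| + k <= #|J :\: J'|.
    elim: k => [|k IHk]; first by rewrite addn0.
    apply: leq_trans IHk; rewrite addnS -addSn leq_add2r.
    have /and5P[_ yJ' wk wJ' _] := nxP _ (stq k (fun j _ => nek j)) (nek k).
    apply/proper_card/properP; split.
      apply/subsetP => x; rewrite qS !inE => /andP[xJ'].
      case/predU1P => [dx | /andP[_ ->]]; last by rewrite xJ'.
      by rewrite dx /y yJ' in xJ'.
    exists (w k); first by rewrite !inE wJ'.
    rewrite qS !inE eqxx /= orbF negb_and negbK; apply/orP; right.
    by apply: contraNneq wJ' => dw; rewrite -/(w k) dw.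
  by have := drop #|J :\: J'|.+1; rewrite addnS ltnNge leq_addl.
case: (ex_minnP exm) => m /eqP qm minm.
have nek k : k < m -> cyc (q k) <> cyc J'.
  by move=> km ek; have := minm k; rewrite ek eqxx leqNgt km => /(_ isT).
have sq k : k <= m -> is_state (q k).
  by move=> km; apply: stq => j jk; apply: nek; apply: leq_trans km.
have okq k : k < m -> [/\ y k \in cyc (q k), y k \in J', w k \in q k, w k \notin J'
                        & w k \in cyc (q k.+1)].
  move=> km; have /and5P[yk yJ' wk wJ' /andP[_ wS]] := nxP _ (sq k (ltnW km)) (nek k km).
  by split.
have memq k : k <= m -> forall x, x \in q k <->
    (x \in J /\ forall j, j < k -> x <> w j) \/ exists2 j, j < k & x = y j.
  elim: k => [|k IHk] km x.
    by split=> [xJ | [[]|[]]//]; left.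
  have [_ yJ' _ wJ' _] := okq k km; rewrite qS in_setU1 in_setD1; split.
    case/predU1P => [-> | /andP[xw /(IHk (ltnW km))[[xJ xo] | [j jk dx]]]].
    - by right; exists k.
    - left; split=> // j; rewrite ltnS leq_eqVlt => /predU1P[-> | /xo //].
      exact/eqP.
    - by right; exists j; rewrite // ltnW.
  case=> [[xJ xo] | [j]].
    apply/orP; right; apply/andP; split; first by apply/eqP/xo.
    by apply/(IHk (ltnW km)); left; split=> // j jk; apply: xo; apply: ltnW.
  rewrite ltnS leq_eqVlt => /predU1P[-> -> | jk dx]; first by rewrite eqxx.
  apply/orP; right; apply/andP; split.
    apply: contraNneq wJ' => <-; rewrite dx.
    by have [] := okq j (ltn_trans jk km).
  by apply/(IHk (ltnW km)); right; exists j.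
have wJ k : k < m -> w k \in J /\ forall j, j < k -> w k <> w j.
  move=> km; have [_ _ wk wJ' _] := okq k km.
  case/(memq k (ltnW km)): wk => // -[j jk dw].
  by have [_ yJ' _ _ _] := okq j (ltn_trans jk km); rewrite dw yJ' in wJ'.
pose R := [set x in J | [forall j : 'I_m, x != w j]].
have inR x : x \in R <-> x \in J /\ forall j, j < m -> x <> w j.
  rewrite inE; split=> [/andP[xJ /forallP xo] | [xJ xo]].
    by split=> // j jm; apply/eqP; apply: (xo (Ordinal jm)).
  by rewrite xJ; apply/forallP => j; apply/eqP/xo.
pose u k := if k < m then w k else y (k - m).
exists R, m, u; split.
  apply/subsetP => x; rewrite inE => /andP[xJ xJ']; apply/inR; split=> // j jm dx.
  by have [_ _ _ + _] := okq j jm; rewrite -dx xJ'.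
have winq k : k <= m -> window R m u k = q k.
  move=> km; apply/setP => x; apply/idP/idP => [/windowP mx | /(memq k km) mx];
    [apply/(memq k km) | apply/windowP]; move: mx.
    case=> [/inR[xJ xo] | [j [kj jkm ->]]].
      by left; split=> // j jk; apply: xo; apply: leq_trans km.
    rewrite /u; case: ltnP => jm; last first.
      by right; exists (j - m); rewrite // ltn_subLR // addnC.
    have [wjJ wjo] := wJ j jm; left; split=> // i ik; apply: wjo.
    exact: leq_trans kj.
  case=> [[xJ xo] | [j jk ->]]; last first.
    right; exists (j + m); rewrite /u [j + m < m]ltnNge leq_addl addnK ltn_add2r jk.
    by split=> //; apply: leq_trans km (leq_addl _ _).
  have [xR | xR] := boolP (x \in R); first by left.
  right; move: xR; rewrite inE xJ /= negb_forall => /existsP[j].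
  rewrite negbK => /eqP dx; exists j; rewrite /u ltn_ord; split=> //.
    by rewrite leqNgt; apply/negP => /xo; apply.
  by rewrite (leq_trans (ltn_ord j)) // leq_addl.
split=> [i im | i im | i im | ].
- by rewrite winq //; apply: sq.
- rewrite winq 1?ltnW // /u ltnNge leq_addl addnK /=.
  by have [] := okq i im.
- by rewrite winq // /u im; have [] := okq i im.
- by rewrite /bad !winq // qm.
Qed.

(** By induction on the number of vertices outside the intersection of the two
    sets: pairs of states sharing more than R are not bad. *)
Theorem states_disjoint J S J' S' : state J S -> state J' S' ->
  S = S' \/ [disjoint S & S'].
Proof.
move=> sJ sJ'; rewrite (state_cyc sJ) (state_cyc sJ').
move: (stateP sJ) (stateP sJ') => {S S'}{}sJ {}sJ'.
have [n] := ubnP (#|V| - #|J :&: J'|).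
elim: n J J' sJ sJ' => // n IHn J J' sJ sJ'; rewrite ltnS => le_n.
apply: contrapT => nogood.
have [|R [m [u [subR chu]]]] := @bad_chain J J' sJ sJ'.
  split; first by move=> eJ; apply: nogood; left.
  by apply/negP => dJ; apply: nogood; right.
apply: (no_chain _ chu) => J1 J2 s1 s2 ltR; apply: IHn => //.
apply: leq_trans le_n; rewrite ltn_sub2l //.
  apply: leq_trans (max_card (mem (J1 :&: J2))).
  by apply: leq_ltn_trans ltR; apply: subset_leq_card.
by apply: leq_ltn_trans ltR; apply: subset_leq_card.
Qed.

End Disjoint.

(** * Counting the edges of a forest *)

Section Forest.

Variable T : finType.
Implicit Types (r : rel T) (E : seq (T * T)).

Definition roots_of r : {set T} := [set root r x | x in [set: T]].

Definition add_edges r E : rel T :=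
  [rel u v | [|| r u v, (u, v) \in E | (v, u) \in E]].

Lemma add_edges_sym r E : symmetric r -> symmetric (add_edges r E).
Proof. by move=> sr u v; rewrite /add_edges /= sr [((u, v) \in E) || _]orbC. Qed.

Lemma roots_of_join r r' x y : symmetric r -> symmetric r' -> subrel r r' ->
  ~~ connect r x y -> connect r' x y -> #|roots_of r'| < #|roots_of r|.
Proof.
move=> sr sr' sub nxy xy; have cr := sym_connect_sym sr; have cr' := sym_connect_sym sr'.
have rr z : root r' (root r z) = root r' z.
  apply/eqP; rewrite root_connect // cr' .
  by apply: connect_sub (connect_root r z) => u v /sub; apply: connect1.
have im : roots_of r' = root r' @: roots_of r.
  by rewrite /roots_of -imset_comp; apply: eq_imset => z /=; rewrite rr.
rewrite im ltn_neqAle leq_imset_card andbT; apply/imset_injP => inj.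
have: root r x = root r y.
  by apply: inj; rewrite ?imset_f ?inE // !rr; apply/eqP; rewrite root_connect.
by move/eqP; rewrite root_connect // (negPf nxy).
Qed.

(** Adding the edges of E one by one, each of them joins two components. *)
Lemma forest_bound r E : symmetric r ->
  (forall E1 p E2, E = E1 ++ p :: E2 -> ~~ connect (add_edges r E1) p.1 p.2) ->
  size E + #|roots_of (add_edges r E)| <= #|roots_of r|.
Proof.
move=> sr; elim/last_ind: E => [|E p IHE] acyc.
  rewrite add0n subset_leq_card //; apply/subsetP => x.
  have -> // : roots_of (add_edges r [::]) = roots_of r.
  apply: eq_imset => z; apply: eq_root => u v.
  by rewrite /add_edges /= !in_nil !orbF.
rewrite size_rcons addSn -addnS; apply: leq_trans (IHE _); last first.
  move=> E1 q E2 dE; apply: (acyc E1 q (rcons E2 p)).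
  by rewrite dE rcons_cat.
rewrite leq_add2l; apply: (@roots_of_join _ _ p.1 p.2); try exact: add_edges_sym.
- move=> u v; rewrite /add_edges /= !mem_rcons !inE.
  by case/or3P => ->; rewrite ?orbT.
- by apply: (acyc E p [::]); rewrite cats1.
- by apply: connect1; rewrite /add_edges /= mem_rcons -surjective_pairing mem_head orbT.
Qed.

End Forest.

(** * Tight sets and the final count *)

Section Count.

Variables (V : finType) (arc : rel V).
Hypotheses (arc_oriented : oriented arc) (G_cubic : subcubic (underlying arc)).
Hypothesis G_bip : bipartite (underlying arc).
Hypothesis G_cut : forall v, linked (underlying arc) (~: [set v]).
Variable P : {set V}.
Hypothesis P_min :
  forall J, optimal (underlying arc) J -> #|P| < #|on_dcyc arc J|.

Implicit Types (I J S Z X : {set V}) (x y z w : V).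

Local Notation e := (underlying arc).
Local Notation conn A := (connect (induced e A)).
Local Notation gated J C := (connect (off e J C)).
Local Notation state := (state arc P).
Local Notation weight := (weight e).

Let e_sym := @und_sym V arc.
Let e_irr := und_irr arc_oriented.

(** There are no triangles in a bipartite graph. *)
Lemma dcyc_card Z : dcyc arc Z -> 4 <= #|Z|.
Proof.
move=> cZ; have [w wZ] : exists w, w \in Z.
  by case: cZ => -[|w s] [_ // _ ->]; exists w; rewrite inE mem_head.
have [p [t [awp pt al t0 [ut ->]]]] := dcyc_at arc_oriented cZ wZ.
rewrite cardsE (card_uniqP ut); case: t => [|q [|//]] // in pt al t0 {ut} *.
move: pt al; rewrite /= andbT => apq aqw; have [X bipX] := G_bip.
have := bipX _ _ (und_arc awp); have := bipX _ _ (und_arc apq); have := bipX _ _ (und_arc aqw).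
by case: (w \in X); case: (p \in X); case: (q \in X).
Qed.

Lemma optimal_weight J J' : optimal e J -> optimal e J' -> weight J = weight J'.
Proof.
by move=> [aJ mJ] [aJ' mJ']; apply/eqP; rewrite eqn_leq mJ // mJ'.
Qed.

Definition family I : {set {set V}} :=
  [set S | `[< exists2 J : {set V}, I \subset J & state J S >]].

Lemma familyP I S : reflect (exists2 J : {set V}, I \subset J & state J S) (S \in family I).
Proof. by rewrite inE; apply: asboolP. Qed.

(** With f the size of the family, J has outside I at most the weight of f - 1
    vertices of degree 3. It cannot have less: J meets every cycle of the family
    but its own, and does so in vertices of degree 3. *)
Definition tight I : Prop := exists J S,
  [/\ I \subset J, state J S & weight J + 4 <= weight I + 4 * #|family I|].

(** No vertex of I can be swapped, in any state that contains I. *)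
Definition uncrossed I : Prop := forall J S w a b, I \subset J -> state J S ->
  w \in I -> e w a -> e w b -> gated J S a b.

(** Otherwise swap some w in I with the gate y of one of its legs. Dropping w
    from I costs 4 in weight, as w has degree 3, but the family gains the new
    cycle, which contains w and so was not in it. So I without w is tight. *)
Lemma tight_uncrossed I : tight I ->
  (forall I', tight I' -> #|I| <= #|I'|) -> uncrossed I.
Proof.
move=> [J0 [S0 [IJ0 s0 tI]]] minI J S w a b IJ sJ wI ewa ewb.
apply: contrapT => nab; have wJ := subsetP IJ w wI.
have aJ := leg_notin (state_optimal sJ) wJ ewa.
have [y yS ay] := state_gate_ex arc_oriented sJ aJ.
have ya : gated J S y a by rewrite gated_sym.
have yb : ~ gated J S y b by move=> yb; apply: nab; apply: connect_trans ay yb.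
have [_ w3] := state_swap_optimal arc_oriented G_cubic sJ wJ yS ewa ewb ya yb.
have [Z [sZ wZ _ _]] := swap_state arc_oriented G_cubic P_min sJ wJ yS ewa ewb ya yb.
suff: tight (I :\ w) by move/minI; rewrite (cardsD1 w I) wI ltnn.
exists (y |: J :\ w), Z; split=> //.
  apply/subsetP => x; rewrite !inE => /andP[xw /(subsetP IJ) ->].
  by rewrite xw orbT.
rewrite (optimal_weight (state_optimal sZ) (state_optimal s0)).
apply: leq_trans tI _; rewrite (weightD1 _ wI) w3 addnC addnA -mulnSr addnC leq_add2l.
rewrite leq_mul2l /=.
have ZI : Z \notin family I.
  apply/familyP => -[J' IJ' sZ'].
  by have := state_notin sZ' wZ; rewrite (subsetP IJ' w wI).
have <- : #|Z |: family I| = #|family I|.+1 by rewrite cardsU1 ZI.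
apply/subset_leq_card/subsetP => S'; rewrite in_setU1 => /predU1P[-> | /familyP[J' IJ' sJ']].
  apply/familyP; exists (y |: J :\ w) => //.
  apply/subsetP => x; rewrite !inE => /andP[xw /(subsetP IJ) ->].
  by rewrite xw orbT.
apply/familyP; exists J' => //; apply: subset_trans IJ'; exact: subD1set.
Qed.

Section Tight.

Variables (I J S : {set V}).
Hypotheses (IJ : I \subset J) (sJ : state J S).
Hypothesis tI : weight J + 4 <= weight I + 4 * #|family I|.
Hypothesis unI : uncrossed I.

Let F := family I.
Let U := cover F.

Lemma mem_UP x : reflect (exists J' S', [/\ I \subset J', state J' S' & x \in S']) (x \in U).
Proof.
apply: (iffP bigcupP) => [[S' /familyP[J' IJ' sJ'] xS'] | [J' [S' [IJ' sJ' xS']]]].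
  by exists J', S'.
by exists S' => //; apply/familyP; exists J'.
Qed.

Lemma S_in_family : S \in F. Proof. by apply/familyP; exists J. Qed.

Lemma memU S' x : S' \in F -> x \in S' -> x \in U.
Proof. by move=> FS' xS'; apply/bigcupP; exists S'. Qed.

Lemma family_eq S1 S2 x : S1 \in F -> S2 \in F -> x \in S1 -> x \in S2 -> S1 = S2.
Proof.
move=> /familyP[J1 _ s1] /familyP[J2 _ s2] x1 x2.
case: (states_disjoint arc_oriented G_cubic P_min s1 s2) => // /disjointFr/(_ x1).
by rewrite x2.
Qed.

Lemma U_notI x : x \in U -> x \notin I.
Proof.
case/mem_UP => J' [S' [IJ' sJ' xS']].
by apply: contra (state_notin sJ' xS'); apply: (subsetP IJ').
Qed.

Lemma U_deg x : x \in U -> #|e x| = 3.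
Proof.
case/mem_UP => J' [S' [_ sJ' xS']].
exact: (state_cyc_deg arc_oriented G_cubic sJ' xS').
Qed.

(** The swaps of [exchange] from J1 to the state of S2 never touch X: a vertex put
    into the set lies on the current cycle, and X remains disjoint from the
    current cycle, to which it cannot become equal since the new cycle contains
    the vertex w taken out of the set. *)
Lemma family_disjoint X J1 S1 S2 :
  (forall J' S', I \subset J' -> state J' S' -> X \subset ~: J' ->
     X = S' \/ [disjoint X & S']) ->
  I \subset J1 -> state J1 S1 -> X \subset ~: J1 -> [disjoint X & S1] ->
  S2 \in F -> [disjoint X & S2].
Proof.
move=> phi + + + + /familyP[J2 IJ2 s2].
have [n] := ubnP #|J1 :\: J2|; elim: n J1 S1 => // n IHn J1 S1.
rewrite ltnS => le_n IJ1 s1 XJ1 XS1.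
have [<- // | /eqP S12] := eqVneq S1 S2.
have [y [w [S3 [yS1 yJ2 wJ1 wJ2 [s3 w3 _]]]]] :=
  exchange arc_oriented G_cubic P_min s1 s2 S12.
have XJ3 : X \subset ~: (y |: J1 :\ w).
  apply/subsetP => x xX; have := subsetP XJ1 x xX.
  rewrite !inE negb_or negb_and => ->; rewrite orbT andbT.
  by apply: contraTneq yS1 => <-; rewrite (disjointFr XS1).
have IJ3 : I \subset y |: J1 :\ w.
  apply/subsetP => x xI; rewrite !inE (subsetP IJ1 x xI) andbT.
  by apply/orP; right; apply: contraNneq wJ2 => <-; exact: (subsetP IJ2).
apply: (IHn (y |: J1 :\ w) S3) => //.
  apply: leq_trans le_n; apply/proper_card/properP; split.
    apply/subsetP => x; rewrite !inE => /andP[xJ2].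
    case/predU1P => [dx | /andP[_ ->]]; last by rewrite xJ2.
    by rewrite dx yJ2 in xJ2.
  exists w; first by rewrite !inE wJ2.
  rewrite !inE eqxx /= orbF negb_and negbK; apply/orP; right.
  by apply: contraNneq wJ2 => ->.
case: (phi _ _ IJ3 s3 XJ3) => // dX.
by have := subsetP XJ1 w; rewrite dX w3 inE wJ1 => /(_ isT).
Qed.

(** If a leg a of w lay on a cycle S' of a state, nothing but a would hang at a,
    by [third_nbrJ]. As all legs of w hang at the same gate, a would be the only
    neighbour of w and a cut-vertex. *)
Lemma legs_notU w a : w \in I -> e w a -> a \notin U.
Proof.
move=> wI ewa; apply/negP => /mem_UP[J' [S' [IJ' sJ' aS']]].
have wJ' := subsetP IJ' w wI; have oJ' := state_optimal sJ'.
have eaw : e a w by rewrite e_sym.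
have [_ stuck] := state_third_nbrJ arc_oriented G_cubic sJ' aS' wJ' eaw.
have only b : e w b -> b = a.
  by move=> ewb; apply: stuck; apply: (unI IJ' sJ' wI).
have [c' [c'S' c'a]] : exists c', c' \in S' /\ c' != a.
  have [c1 [c2 [c1S c2S c12 _ _]]] := ucyc_nbrs e_sym (state_ucyc arc_oriented sJ') aS'.
  have [c1a | c1a] := eqVneq c1 a; last by exists c1.
  by exists c2; split=> //; rewrite -c1a eq_sym.
have wa : w != a by apply: contraTneq eaw => ->; rewrite e_irr.
have: [pred x | x == w] c'.
  apply: (connect_closed_in (r := induced e (~: [set a])) (x := w)).
  - move=> u v; rewrite inducedE !inE => /and3P[_ va euv] /eqP du.
    by rewrite du in euv; rewrite (only v euv) eqxx in va.
  - exact: eqxx.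
  - by apply: G_cut; rewrite !inE.
move=> /= /eqP dc'; have := state_notin sJ' c'S'.
by rewrite dc' wJ'.
Qed.

(** A path in the complement of J that joins the legs closes up to a cycle
    through w. The legs have a common gate, so by [cyc_thru_legs] this cycle
    avoids the cycle of every state that contains I and leaves the path, and
    [family_disjoint] extends this to the whole family. *)
Lemma hub_legs w a b : w \in I -> e w a -> e w b -> conn (~: J :\: U) a b.
Proof.
move=> wI ewa ewb; have [-> | ab] := eqVneq a b; first exact: connect0.
have wJ := subsetP IJ w wI.
have aJ := leg_notin (state_optimal sJ) wJ ewa.
have cab : conn (~: J) a b.
  apply: connect_sub (unI IJ sJ wI ewa ewb) => u v; rewrite offE.
  by case/and4P => uJ vJ euv _; apply: conn1; rewrite ?inE.
have aA : a \in ~: J by rewrite inE.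
have [s [ps us sA db]] := conn_simple_path aA cab.
have s0 : s != [::] by apply: contraNneq ab => s0; rewrite -db s0.
pose X := [set x in a :: s].
have XJ' J' : {subset a :: s <= ~: J'} -> X \subset ~: J'.
  by move=> sub; apply/subsetP => x; rewrite inE => /sub.
have disX J' S' : I \subset J' -> state J' S' -> X \subset ~: J' -> [disjoint X & S'].
  move=> IJ' sJ' XJ2; apply: contraT => meet.
  have wJ' := subsetP IJ' w wI.
  have subJ' : {subset a :: s <= ~: J'} by move=> x xs; apply: (subsetP XJ2); rewrite inE.
  have uw : uniq (w :: a :: s).
    by rewrite cons_uniq us andbT; apply/negP => /subJ'; rewrite inE wJ'.
  have pw : path e w (a :: s) by rewrite /= ewa.
  have lw : e (last a s) w by rewrite db e_sym.
  have mw : ~~ [disjoint [set x in w :: a :: s] & S'].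
    apply: contra meet; apply: disjointWl; apply/subsetP => x; rewrite !inE => ->.
    by rewrite orbT.
  have := state_cyc_thru_legs arc_oriented G_cubic sJ' wJ' pw uw lw s0 subJ' mw.
  by case; rewrite db; apply: (unI IJ' sJ' wI).
have XJ := XJ' J sA.
have XS := disX J S IJ sJ XJ.
rewrite -db; apply: (conn_path ps); last exact: mem_last.
move=> x xs; rewrite in_setD sA // andbT; apply/bigcupP => -[S' FS' xS'].
have dXS' : [disjoint X & S'].
  by apply: (family_disjoint (J1 := J) (S1 := S)) => // J' S2 *; right; apply: (disX J').
by have := disjointFl dXS' xS'; rewrite inE xs.
Qed.

(** By [cyc_eq], a cycle left by J is equal to or disjoint from the cycle of any
    state that leaves it. *)
Lemma cycles_avoidU Z : ucyc e Z -> Z \subset ~: J -> Z <> S -> [disjoint Z & U].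
Proof.
move=> cZ ZJ ZS.
have phi J' S' : I \subset J' -> state J' S' -> Z \subset ~: J' -> Z = S' \/ [disjoint Z & S'].
  move=> IJ' sJ' ZJ'; have [d | meet] := boolP [disjoint Z & S']; [by right | left].
  exact: (state_cyc_eq arc_oriented G_cubic sJ' cZ ZJ' meet).
have dZS : [disjoint Z & S] by case: (phi J S IJ sJ ZJ).
apply/pred0P => x /=; apply/negP => /andP[xZ /bigcupP[S' FS' xS']].
by have := family_disjoint phi IJ sJ ZJ dZS FS'; move/disjointFr/(_ xZ); rewrite xS'.
Qed.

Lemma weight_split : weight J = weight I + \sum_(v in J :\: I) (#|e v|).+1.
Proof. by rewrite /weight (big_setID I) /= (setIidPr IJ). Qed.

Lemma weight_JU : 4 * #|J :&: U| + \sum_(v in (J :\: I) :\: U) (#|e v|).+1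
  = \sum_(v in J :\: I) (#|e v|).+1.
Proof.
rewrite [RHS](big_setID U) /=; congr (_ + _).
have -> : (J :\: I) :&: U = J :&: U.
  apply/setP => x; rewrite !inE; case: (boolP (x \in U)) => [/U_notI -> // |].
  by rewrite !andbF.
rewrite mulnC -sum_nat_const; apply: eq_bigr => x.
by rewrite inE => /andP[_ /U_deg ->].
Qed.

Lemma family_meetJ S' : S' \in F -> S' != S -> exists2 x, x \in S' & x \in J.
Proof.
case/familyP => J' _ sJ' /eqP S'S.
exact: (state_meet arc_oriented G_cubic sJ' sJ S'S).
Qed.

(** A vertex of J on each cycle of the family other than S, which exists by
    [state_meet]. *)
Definition J_rep S' : option V := [pick x in S' :&: J].

Lemma J_rep_card : #|F :\ S| = #|J_rep @: (F :\ S)|.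
Proof.
rewrite card_in_imset // => S1 S2; rewrite !in_setD1 => /andP[S1S F1] /andP[S2S F2].
rewrite /J_rep; case: pickP => [x1 /setIP[x1S _] | no1]; last first.
  by have [x xS xJ] := family_meetJ F1 S1S; have := no1 x; rewrite inE xS xJ.
case: pickP => // x2 /setIP[x2S _] [d12]; apply: (family_eq F1 F2 x1S).
by rewrite d12.
Qed.

Lemma J_rep_sub : J_rep @: (F :\ S) \subset [set Some x | x in J :&: U].
Proof.
apply/subsetP => ox /imsetP[S']; rewrite in_setD1 => /andP[S'S FS'] ->.
rewrite /J_rep; case: pickP => [x /setIP[xS xJ] | no1]; last first.
  by have [x xS xJ] := family_meetJ FS' S'S; have := no1 x; rewrite inE xS xJ.
by apply: imset_f; rewrite inE xJ (memU FS').
Qed.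

(** At least, because each cycle of the family other than S meets J; at most,
    because each vertex of U has weight 4 and I is tight. *)
Lemma card_JU : #|J :&: U| = #|F|.-1.
Proof.
apply/eqP; rewrite eqn_leq; apply/andP; split.
  have := tI; rewrite weight_split -addnA leq_add2l -weight_JU addnC => le.
  have : 4 + 4 * #|J :&: U| <= 4 * #|F|.
    by apply: leq_trans le; rewrite leq_add2l leq_addr.
  by rewrite -mulnS leq_pmul2l // => le4; rewrite -ltnS prednK // (leq_trans _ le4).
have := subset_leq_card J_rep_sub; rewrite -J_rep_card.
rewrite card_imset; last by move=> x y [].
by rewrite (cardsD1 S F) S_in_family.
Qed.

Lemma F_gt0 : 0 < #|F|.
Proof. by apply/card_gt0P; exists S; exact: S_in_family. Qed.

(** The vertices of J in U use up the whole weight that tightness leaves outside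
    I. *)
Lemma J_cases x : x \in J -> x \in I \/ x \in U.
Proof.
move=> xJ; have [xI | xI] := boolP (x \in I); [by left | right].
apply: contraT => xU; have := tI; rewrite weight_split -addnA leq_add2l -weight_JU.
rewrite card_JU (bigD1 x) /=; last by rewrite !inE xU xI.
rewrite -{2}(prednK F_gt0) mulnS addnC leq_add2l -[X in _ <= X]addn0 leq_add2l.
by rewrite addSn ltn0.
Qed.

(** The members of the family other than S number as many as the vertices of J
    in U, and each contains one. *)
Lemma one_J_per_cycle S' x y : S' \in F -> x \in S' -> y \in S' -> x \in J -> y \in J -> x = y.
Proof.
move=> FS' xS yS xJ yJ; apply/eqP; apply: contraT => xy.
have S'S : S' != S.
  by apply: contraTneq xJ => dS'; rewrite dS' in xS; apply: state_notin sJ xS.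
have [z [zS zJ zrep]] : exists z, [/\ z \in S', z \in J & J_rep S' != Some z].
  have [ex | ex] := eqVneq (J_rep S') (Some x); last by exists x.
  by exists y; split=> //; rewrite ex; apply: contra xy => /eqP[->].
have: #|Some z |: J_rep @: (F :\ S)| <= #|[set Some x | x in J :&: U]|.
  apply/subset_leq_card; rewrite subUset J_rep_sub andbT sub1set.
  by apply: imset_f; rewrite inE zJ (memU FS').
rewrite card_imset; last by move=> ? ? [].
rewrite card_JU cardsU1 -J_rep_card (cardsD1 S F) S_in_family /=.
case: imsetP => [[S2] | _]; last by rewrite ltnn.
rewrite in_setD1 => /andP[S2S F2] dz.
have zS2 : z \in S2.
  by move: (dz); rewrite /J_rep; case: pickP => // z' /setIP[z'S _] [->].
by case/eqP: zrep; rewrite (family_eq FS' F2 zS zS2).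
Qed.

Definition same x y := [exists S' in F, (x \in S') && (y \in S')].

Lemma sameP x y : reflect (exists S', [/\ S' \in F, x \in S' & y \in S']) (same x y).
Proof.
apply: (iffP existsP) => [[S' /and3P[FS' xS yS]] | [S' [FS' xS yS]]]; exists S' => //.
by rewrite FS' xS.
Qed.

Lemma same_sym x y : same x y = same y x.
Proof. by apply: eq_existsb => S'; rewrite [(x \in S') && _]andbC. Qed.

Lemma same_memU x y : same x y -> (x \in U) && (y \in U).
Proof. by case/sameP => S' [FS' xS yS]; rewrite !(memU FS'). Qed.

(** The edges that are contracted: those inside a hub and those joining
    two vertices of one cycle of the family. *)
Definition piece : rel V :=
  [rel x y | e x y && ((x \notin U) && (y \notin U) || same x y)].

Lemma pieceE x y : piece x y = e x y && ((x \notin U) && (y \notin U) || same x y).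
Proof. by []. Qed.

Lemma piece_sym : symmetric piece.
Proof. by move=> x y; rewrite !pieceE e_sym same_sym [(x \notin U) && _]andbC. Qed.

Lemma piece_connect_sym : connect_sym piece.
Proof. exact/sym_connect_sym/piece_sym. Qed.

(** The components of the complement of U, through their representatives. *)
Definition hubs : {set V} := [set root piece x | x in ~: U].

Lemma roots_piece : #|roots_of piece| <= #|hubs| + #|F|.
Proof.
pose f S' : option V := omap (root piece) [pick x in S'].
have sub : [set Some x | x in roots_of piece] \subset
    [set Some x | x in hubs] :|: [set f S' | S' in F].
  apply/subsetP => ox /imsetP[x /imsetP[z _ ->] ->].
  have [zU | zU] := boolP (z \in U); last first.
    by rewrite inE imset_f // imset_f // inE.
  rewrite inE; apply/orP; right; case/bigcupP: zU => S' FS' zS'.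
  apply/imsetP; exists S' => //; rewrite /f; case: pickP => [x' x'S | no]; last first.
    by have := no z; rewrite zS'.
  congr Some; apply/eqP; rewrite root_connect; last exact: piece_connect_sym.
  have [J' _ sJ'] := familyP _ _ FS'.
  have [s ds] : exists s, [/\ path e z s, last z s = x' & {subset z :: s <= S'}].
    have := ucyc_at (state_ucyc arc_oriented sJ') zS'.
    case=> y [t [ezy pyt _ _ [_ dS']]].
    move: x'S; rewrite dS' inE inE => /predU1P[-> | x't].
      by exists [::]; split=> // u; rewrite !inE => /eqP ->; rewrite eqxx.
    have [t1 [t2 dt]] : exists t1 t2, y :: t = rcons t1 x' ++ t2.
      by case/splitPr: x't => t1 t2; exists t1, t2; rewrite cat_rcons.
    exists (rcons t1 x'); split; last 2 first.
    - by rewrite last_rcons.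
    - move=> u; rewrite inE => /predU1P[-> | ut]; rewrite !inE ?eqxx //.
      by rewrite -in_cons dt mem_cat ut orbT.
    have : path e z (y :: t) by rewrite /= ezy.
    by rewrite dt cat_path => /andP[].
  case: ds => ps <- sS'.
  have := conn_path ps sS' (mem_last _ _); apply: connect_sub => u v.
  rewrite inducedE => /and3P[uS vS euv]; apply: connect1; rewrite pieceE euv /=.
  by apply/orP; right; apply/sameP; exists S'.
have some_inj : injective (@Some V) by move=> ? ? [].
rewrite -(card_imset _ some_inj) -(card_imset hubs some_inj).
apply: leq_trans (subset_leq_card sub) _; apply: leq_trans (leq_card_setU _ _) _.
by rewrite leq_add2l leq_imset_card.
Qed.

(** The ways from x to y that do not use the edge xy: through the complement of J
    or within hubs and cycles of the family, J included. *)
Definition detour x y : rel V := [rel u v | [&& e u v,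
  ~~ ((u == x) && (v == y) || (u == y) && (v == x))
  & (u \notin J) && (v \notin J) || piece u v]].

Lemma detourE x y u v : detour x y u v = [&& e u v,
  ~~ ((u == x) && (v == y) || (u == y) && (v == x))
  & (u \notin J) && (v \notin J) || piece u v].
Proof. by []. Qed.

(** A detour may be taken to avoid J: a passage through a vertex v of J stays
    inside a hub or on a cycle of the family, and it can be replaced by one in
    the same hub, by [hub_legs], or along the rest of the cycle, which contains
    no vertex of J but v. With the edge xy it forms a cycle left by J, which
    contains x in U and differs from S, against [cycles_avoidU]. *)
Lemma detour_acyclic x y : e x y -> x \notin J -> y \notin J -> x \in U ->
  ~~ same x y -> ~~ connect (detour x y) x y.
Proof.
move=> exy xJ yJ xU nxy; apply/negP => cxy.
pose D : rel V := [rel u v | [&& u \notin J, v \notin J, e u v &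
  ~~ ((u == x) && (v == y) || (u == y) && (v == x))]].
have DE u v : D u v = [&& u \notin J, v \notin J, e u v &
  ~~ ((u == x) && (v == y) || (u == y) && (v == x))] by [].
have [[iJ _ _] _] := state_optimal sJ.
(* Bypassing a vertex of J. *)
have inner v n n' : v \in J -> piece v n -> piece v n' -> connect D n n'.
  move=> vJ; rewrite !pieceE => /andP[evn pvn] /andP[evn' pvn'].
  case: (J_cases vJ) => [vI | vU].
    apply: connect_sub (hub_legs vI evn evn') => a b; rewrite inducedE !inE.
    case/and3P => /andP[aU aJ] /andP[bU bJ] eab; apply: connect1.
    rewrite DE aJ bJ eab /=; apply/negP => /orP[] /andP[/eqP da /eqP db].
      by rewrite da xU in aU.
    by rewrite db xU in bU.
  move: pvn pvn'; rewrite vU /= => /sameP[S1 [F1 v1 n1]] /sameP[S2 [F2 v2 n2]].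
  have dS := family_eq F2 F1 v2 v1; rewrite {}dS {S2 F2 v2} in n2.
  have [J1 _ s1] := familyP _ _ F1.
  have nv : n != v by apply: contraTneq evn => ->; rewrite e_irr.
  have nv' : n' != v by apply: contraTneq evn' => ->; rewrite e_irr.
  have := ucyc_conn_del e_sym (state_ucyc arc_oriented s1) n1 n2 nv nv'.
  apply: connect_sub => a b; rewrite inducedE !in_setD1.
  case/and3P => /andP[av a1] /andP[bv b1] eab; apply: connect1.
  have aJ : a \notin J by apply: contra av => aJ; apply/eqP/(one_J_per_cycle F1).
  have bJ : b \notin J by apply: contra bv => bJ; apply/eqP/(one_J_per_cycle F1).
  rewrite DE aJ bJ eab /=.
  apply: contra nxy => /orP[] /andP[/eqP da /eqP db]; apply/sameP; exists S1; split=> //.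
  - by rewrite -da.
  - by rewrite -db.
  - by rewrite -db.
  - by rewrite -da.
pose K := [pred z | if z \in J then [forall n, piece z n ==> connect D x n]
                    else connect D x z].
have: K y.
  apply: (connect_closed_in _ _ cxy) => [u v | ]; last by rewrite /= (negPf xJ) connect0.
  case/and3P => euv nuv uvJ; rewrite /=.
  have [uJ | uJ] := boolP (u \in J); have [vJ | vJ] := boolP (v \in J).
  - by have := iJ u v uJ vJ; rewrite euv.
  - by move/forallP/(_ v)/implyP; apply; move: uvJ; rewrite uJ.
  - move=> cxu; apply/forallP => n; apply/implyP => pvn.
    apply: connect_trans cxu _; apply: (inner v) => //.
    by move: uvJ; rewrite vJ andbF /= piece_sym.
  - move=> cxu; apply: connect_trans cxu (connect1 _).
    by rewrite DE uJ vJ euv.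
rewrite /= (negPf yJ) => /connectP[s0 p0 dy]; case/shortenP: p0 dy => s ps us _ dy.
have pe : path e x s by apply: sub_path ps => u v; rewrite DE => /and4P[].
have sJ' : {subset x :: s <= ~: J}.
  move=> u; rewrite inE => /predU1P[-> | us']; first by rewrite inE.
  have: all (fun v => v \notin J) s.
    elim: (s) (x) ps {us us' dy pe} => //= v s' IHs u'; rewrite DE.
    by case/andP => /and4P[_ -> _ _] /IHs.
  by move/allP/(_ u us'); rewrite inE.
have s_gt1 : 1 < size s.
  case: s ps dy {us pe sJ'} => [_ dy | v [|//]].
    by rewrite /= in dy; rewrite dy e_irr in exy.
  by rewrite /= andbT DE => + dy; rewrite -dy !eqxx /= !andbF.
have cZ : ucyc e [set z in x :: s].
  exists (x :: s); split=> //.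
  by rewrite /ucycle us andbT /= rcons_path pe -dy e_sym.
have ZJ : [set z in x :: s] \subset ~: J by apply/subsetP => z; rewrite inE => /sJ'.
have ZS : [set z in x :: s] <> S.
  move=> dZ; case/sameP: nxy; exists S; split; first exact: S_in_family.
    by rewrite -dZ inE mem_head.
  by rewrite -dZ inE dy mem_last.
by have := cycles_avoidU cZ ZJ ZS; move/disjointFl/(_ xU); rewrite inE mem_head.
Qed.

(** The edges of the contracted graph, each one taken in both directions. Edges
    inside the complement of U are not among them, as they are contracted. *)
Definition darts : {set V * V} :=
  [set d | [&& e d.1 d.2, ~~ same d.1 d.2 & (d.1 \in U) || (d.2 \in U)]].

(** This is the edge to the third neighbour. *)
Lemma outlet x : x \in U -> exists z, [/\ e x z, ~~ same x z &
  forall z', e x z' -> ~~ same x z' -> z' = z].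
Proof.
move=> xU; case/bigcupP: (xU) => S' FS' xS'; have [J' _ sJ'] := familyP _ _ FS'.
have [p [q [z [ex u3 [pS qS] zS]]]] := state_third_nbr arc_oriented G_cubic sJ' xS'.
exists z; split.
- by have := ex z; rewrite !inE eqxx !orbT.
- apply: contra zS => /sameP[S2 [F2 x2 z2]].
  by rewrite (family_eq FS' F2 xS' x2).
- move=> z' exz' nz'; have: z' \in [:: p; q; z] by rewrite -ex.
  rewrite !inE => /or3P[] /eqP dz' //; case/sameP: nz'; exists S'; rewrite dz'; split=> //.
Qed.

Lemma darts_swap d : (d \in darts) = ((d.2, d.1) \in darts).
Proof. by rewrite !inE /= e_sym same_sym orbC. Qed.

Lemma dart_inj d d' : d \in darts -> d' \in darts -> d.1 \in U -> d.1 = d'.1 -> d = d'.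
Proof.
case: d d' => [x y] [x' y']; rewrite !inE /= => /and3P[exy nxy _] /and3P[exy' nxy' _] xU dx.
have [z [_ _ uz]] := outlet xU; rewrite -dx in exy' nxy' *.
by rewrite (uz y) // (uz y').
Qed.

Lemma dart_JU d : d \in darts -> d.1 \in J -> d.1 \in U.
Proof.
rewrite inE => /and3P[ed nd oU] dJ; case: (J_cases dJ) => // dI.
case/orP: oU => // d2U; by rewrite (negPf (legs_notU dI ed)) in d2U.
Qed.

Lemma darts_from_J : #|[set d in darts | d.1 \in J]| <= #|F|.-1.
Proof.
rewrite -card_JU -(card_in_imset (f := fst)).
  apply/subset_leq_card/subsetP => x /imsetP[d]; rewrite inE => /andP[dd dJ] ->.
  by rewrite inE dJ dart_JU.
move=> d d'; rewrite !inE => /andP[dd dJ] /andP[dd' _] d1.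
by apply: dart_inj; rewrite ?inE //; apply: dart_JU; rewrite ?inE.
Qed.

(** One dart for each edge of the contracted graph that avoids J. *)
Definition free_darts : {set V * V} := [set d in darts |
  [&& d.1 \notin J, d.2 \notin J & enum_rank d.1 < enum_rank d.2]].

Lemma darts_le : #|darts| <= 2 * #|F|.-1 + 2 * #|free_darts|.
Proof.
pose sw (d : V * V) := (d.2, d.1).
have sw_inj : injective sw by move=> [a b] [a' b'] [-> ->].
pose A := [set d in darts | d.1 \in J].
have sub : darts \subset (A :|: sw @: A) :|: (free_darts :|: sw @: free_darts).
  apply/subsetP => d dd; have dd' : sw d \in darts by rewrite -darts_swap.
  have dsw : d = sw (sw d) by case: (d).
  have [d1 | d1] := boolP (d.1 \in J); first by apply/setUP; left; apply/setUP; left; rewrite inE dd.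
  have [d2 | d2] := boolP (d.2 \in J).
    by apply/setUP; left; apply/setUP; right; rewrite dsw imset_f // inE dd'.
  apply/setUP; right; apply/setUP.
  case: (ltngtP (enum_rank d.1) (enum_rank d.2)) => [lt | gt | eq].
  - by left; rewrite inE dd d1 d2.
  - by right; rewrite dsw imset_f // inE dd' /= d1 d2.
  - have /enum_rank_inj d12 := val_inj eq.
    by move: dd; rewrite inE d12 e_irr.
apply: leq_trans (subset_leq_card sub) _.
apply: leq_trans (leq_card_setU _ _) _.
rewrite !mul2n -!addnn; apply: leq_add.
  apply: leq_trans (leq_card_setU _ _) _; apply: leq_add; first exact: darts_from_J.
  by rewrite card_imset //; exact: darts_from_J.
by apply: leq_trans (leq_card_setU _ _) _; rewrite card_imset.
Qed.

(** By [detour_acyclic] these edges form a forest on the hubs and the cycles of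
    the family. *)
Lemma free_darts_le : #|free_darts| < #|hubs| + #|F|.
Proof.
have acyc E1 p E2 : enum free_darts = E1 ++ p :: E2 -> ~~ connect (add_edges piece E1) p.1 p.2.
  move=> dE; have uE : uniq (E1 ++ p :: E2) by rewrite -dE enum_uniq.
  have memE q : q \in E1 ++ p :: E2 -> q \in free_darts by rewrite -dE mem_enum.
  have ph : p \in free_darts by apply: memE; rewrite mem_cat mem_head orbT.
  have E1h q : q \in E1 -> q \in free_darts /\ q != p.
    move=> qE; split; first by apply: memE; rewrite mem_cat qE.
    apply: contraTneq qE => ->; move: uE; rewrite cat_uniq /= negb_or.
    by case/and3P => _ /andP[].
  case: p => [x y] in dE uE memE ph E1h *.
  move: (ph); rewrite !inE /= => /andP[/and3P[exy nxy oU] /and3P[xJ yJ lt]].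
  have sub : subrel (add_edges piece E1) (detour x y).
    have hedge u v : (u, v) \in E1 -> detour x y u v && detour x y v u.
      case/E1h; rewrite !inE /= xpair_eqE => /andP[/and3P[euv _ _] /and3P[uJ vJ lt']] neq.
      have h2 : ~~ ((u == y) && (v == x)).
        apply/negP => /andP[/eqP du /eqP dv]; rewrite du dv in lt'.
        by have := ltn_trans lt lt'; rewrite ltnn.
      rewrite (detourE x y u v) (detourE x y v u) [e v u]e_sym euv uJ vJ /= !andbT.
      rewrite [(v == x) && _]andbC [(v == y) && _]andbC [X in _ && ~~ X]orbC andbb.
      by rewrite negb_or neq h2.
    move=> u v /or3P[puv | /hedge/andP[] // | /hedge/andP[] //].
    move: (puv); rewrite pieceE => /andP[euv pp].
    have nz a b : (a == x) && (b == y) -> piece a b -> False.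
      case/andP => /eqP -> /eqP ->; rewrite pieceE (negPf nxy) orbF => /andP[_ /andP[]].
      by case/orP: oU => ->.
    rewrite detourE euv puv orbT andbT /= negb_or.
    apply/andP; split; apply/negP => h; first exact: nz h puv.
    have pvu : piece v u by rewrite piece_sym.
    by rewrite andbC in h; exact: nz h pvu.
  apply: contra (_ : ~~ connect (detour x y) x y) => /=.
    by apply: connect_sub => u v /sub; apply: connect1.
  case/orP: oU => [xU | yU]; first exact: detour_acyclic.
  have asym : symmetric (detour x y).
    move=> u v; rewrite (detourE x y u v) (detourE x y v u) [e v u]e_sym [piece v u]piece_sym.
    rewrite [(u \notin J) && _]andbC; congr (_ && (~~ _ && _)).
    by rewrite orbC [(u == x) && _]andbC [(u == y) && _]andbC.
  have aeq : detour x y =2 detour y x.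
    by move=> u v; rewrite (detourE x y) (detourE y x) orbC.
  rewrite (sym_connect_sym asym) (eq_connect aeq).
  by apply: detour_acyclic => //; [rewrite e_sym | rewrite same_sym].
have := forest_bound piece_sym acyc; rewrite -cardE => le.
apply: leq_trans roots_piece; apply: leq_trans le; rewrite -addn1 leq_add2l.
have [x xS] : exists x, x \in S.
  by case: (state_dcyc sJ) => -[|x s] [_ // _ ->]; exists x; rewrite inE mem_head.
by apply/card_gt0P; exists (root (add_edges piece (enum free_darts)) x); apply: imset_f.
Qed.

(** A hub with all its edges to the same vertex u of U would be cut off from the
    rest of U by u. *)
Lemma hub_darts rho : rho \in hubs ->
  1 < #|[set d in darts | (d.1 \notin U) && (root piece d.1 == rho)]|.
Proof.
case/imsetP => x0; rewrite inE => x0U drho.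
have away u : u \in U -> exists d, [/\ d \in darts, d.1 \notin U, root piece d.1 == rho & d.2 != u].
  move=> uU; apply: contrapT => none.
  have [u' [u'U u'u]] : exists u', u' \in U /\ u' != u.
    case/bigcupP: (uU) => S' FS' uS'; have [J' _ sJ'] := familyP _ _ FS'.
    have [u1 [_ [u1S _ _ eu _]]] := ucyc_nbrs e_sym (state_ucyc arc_oriented sJ') uS'.
    exists u1; split; first exact: memU u1S.
    by apply: contraTneq eu => ->; rewrite e_irr.
  have: [pred z | (z \notin U) && (root piece z == rho)] u'.
    apply: (connect_closed_in (r := induced e (~: [set u])) (x := x0)).
    - move=> a b; rewrite inducedE !inE => /and3P[au bu eab] /= /andP[aU ra].
      have nsab : ~~ same a b by apply: contra aU => /same_memU /andP[].
      have [bU | bU] := boolP (b \in U).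
        by case: none; exists (a, b); rewrite inE /= eab nsab bU orbT.
      rewrite /= -(eqP ra) root_connect; last exact: piece_connect_sym.
      by apply: connect1; rewrite piece_sym pieceE eab aU bU.
    - by rewrite /= x0U drho eqxx.
    - apply: G_cut; rewrite !inE //.
      by apply: contraNneq x0U => ->.
  by rewrite /= u'U.
have [u uS] : exists u, u \in S.
  by case: (state_dcyc sJ) => -[|u s] [_ // _ ->]; exists u; rewrite inE mem_head.
have uU : u \in U := memU S_in_family uS.
have [d [dd d1 dr _]] := away u uU.
have d2U : d.2 \in U by move: dd; rewrite inE (negPf d1) => /and3P[].
have [d' [dd' d1' dr' d2']] := away d.2 d2U.
apply/card_gt1P; exists d, d'; split.
- by rewrite inE dd d1 dr.
- by rewrite inE dd' d1' dr'.
- by apply: contraNneq d2' => ->.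
Qed.

Lemma darts_hubs : 2 * #|hubs| <= #|[set d in darts | d.1 \notin U]|.
Proof.
rewrite -[X in _ <= X]sum1_card.
rewrite (partition_big (fun d : V * V => root piece d.1) (mem hubs)) /=.
  rewrite mulnC -sum_nat_const; apply: leq_sum => rho /hub_darts/leq_trans; apply.
  rewrite -sum1_card; apply: eq_leq; apply: eq_bigl => d.
  by rewrite in_set [in RHS]in_set andbA.
by move=> d; rewrite in_set => /andP[_ d1]; apply: imset_f; rewrite in_setC.
Qed.

Lemma card_U : 4 * #|F| <= #|U|.
Proof.
have triv : trivIset F.
  apply/trivIsetP => S1 S2 F1 F2 S12; apply/pred0P => x /=.
  by apply/negP => /andP[x1 x2]; rewrite (family_eq F1 F2 x1 x2) eqxx in S12.
rewrite -(eqP triv) mulnC -sum_nat_const; apply: leq_sum => S' /familyP[J' _ sJ'].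
exact: dcyc_card (state_dcyc sJ').
Qed.

Lemma darts_U : #|U| <= #|[set d in darts | d.1 \in U]|.
Proof.
apply: leq_trans (leq_imset_card fst _); apply/subset_leq_card/subsetP => x xU.
have [z [exz nxz _]] := outlet xU.
by apply/imsetP; exists (x, z); rewrite // !inE /= exz nxz xU.
Qed.

Lemma tight_contra : False.
Proof.
have lower : 4 * #|F| + 2 * #|hubs| <= #|darts|.
  rewrite -(cardsID [set d : V * V | d.1 \in U] darts); apply: leq_add.
    apply: leq_trans card_U (leq_trans darts_U (eq_leq _)).
    by apply: eq_card => d; rewrite in_set in_setI; congr (_ && _); rewrite in_set.
  apply: leq_trans darts_hubs (eq_leq _); apply: eq_card => d.
  by rewrite in_set in_setD andbC; congr (~~ _ && _); rewrite in_set.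
have := leq_trans lower darts_le; have := free_darts_le; have := F_gt0.
case: #|F| => // f _; rewrite addnS ltnS /= => le_free le_darts.
have := leq_trans le_darts (leq_add (leqnn _) (leq_mul (leqnn 2) le_free)).
by rewrite mulnDr addnCA addnC leq_add2l -mulnDl -[2 + 2]/4 mulnS -[X in _ <= X]add0n leq_add2r.
Qed.

End Tight.
End Count.

(** * Existence of the partition *)

Section Existence.

Variables (V : finType) (arc : rel V).
Hypothesis arc_oriented : oriented arc.

Local Notation e := (underlying arc).

(** J itself is tight, since S is in its family. *)
Lemma exists_tight (P J S : {set V}) :
  (forall J', optimal e J' -> #|P| < #|on_dcyc arc J'|) -> state arc P J S ->
  exists2 I : {set V}, tight arc P I & forall I', tight arc P I' -> #|I| <= #|I'|.
Proof.
move=> P_min sJ; have tJ : tight arc P J.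
  exists J, S; split=> //; rewrite leq_add2l -{1}[4]muln1 leq_mul2l /=.
  by apply/card_gt0P; exists S; apply/familyP; exists J.
have ex : exists n, [exists I : {set V}, `[< tight arc P I >] && (#|I| == n)].
  by exists #|J|; apply/existsP; exists J; rewrite eqxx andbT; apply/asboolP.
case: (ex_minnP ex) => n /existsP[I /andP[/asboolP tI /eqP dI]] minn.
exists I => // I' tI'; rewrite dI; apply: minn; apply/existsP; exists I'.
by rewrite eqxx andbT; apply/asboolP.
Qed.

Lemma exists_optimal : two_vertex_connected e ->
  exists2 J : {set V}, optimal e J & forall J', optimal e J' -> #|on_dcyc arc J| <= #|on_dcyc arc J'|.
Proof.
case=> [[[x0 _] lT] _].
have a0 : admissible e set0.
  split; first by move=> x y; rewrite inE.
    by rewrite setC0.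
  by exists x0; rewrite inE.
pose wts n := [exists J : {set V}, `[< admissible e J >] && (weight e J == n)].
have exw : exists n, wts n.
  by exists (weight e set0); apply/existsP; exists set0; rewrite eqxx andbT; apply/asboolP.
have bound n : wts n -> n <= weight e setT.
  case/existsP => J /andP[_ /eqP <-].
  by rewrite /weight [leqRHS](big_setID J) /= setTI leq_addr.
case: (ex_maxnP exw bound) => n /existsP[J1 /andP[/asboolP aJ1 /eqP wJ1]] maxw.
have oJ1 : optimal e J1.
  split=> // J' aJ'; rewrite wJ1; apply: maxw; apply/existsP; exists J'.
  by rewrite eqxx andbT; apply/asboolP.
have exd : exists n, [exists J : {set V}, `[< optimal e J >] && (#|on_dcyc arc J| == n)].
  by exists #|on_dcyc arc J1|; apply/existsP; exists J1; rewrite eqxx andbT; apply/asboolP.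
case: (ex_minnP exd) => k /existsP[J /andP[/asboolP oJ /eqP dJ]] mind.
exists J => // J' oJ'; rewrite dJ; apply: mind; apply/existsP; exists J'.
by rewrite eqxx andbT; apply/asboolP.
Qed.

Theorem CAI_partition_exists :
  bipartite e -> two_vertex_connected e -> subcubic e ->
  exists A I : {set V}, CAI_partition arc A I.
Proof.
move=> G_bip G_2conn G_cubic; have [J oJ minJ] := exists_optimal G_2conn.
have [D0 | /set0Pn[x /on_dcycP[S [cS SJ xS]]]] := eqVneq (on_dcyc arc J) set0.
  have [[iJ lJ [x xJ]] _] := oJ.
  exists (~: J), J; split=> //.
  - by rewrite setUC setUCr.
  - by rewrite disjoint_sym disjoints_subset setCK.
  - by split=> //; exists x; rewrite inE.
  - move=> c cc csub; apply: contraTeq isT => c0.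
    have /set0Pn[] : on_dcyc arc J != set0; last by rewrite D0 => y; rewrite inE.
    have [y yc] : exists y, y \in c by case: (c) c0 => // y c' _; exists y; rewrite mem_head.
    apply/set0Pn; exists y; apply/on_dcycP; exists [set z in c]; split.
    + by exists c; split.
    + by apply/subsetP => z; rewrite inE; apply: csub.
    + by rewrite inE.
exfalso; pose P := on_dcyc arc J :\: S.
have SD : S \subset on_dcyc arc J by apply/subsetP => z zS; apply/on_dcycP; exists S.
have P_min J' : optimal e J' -> #|P| < #|on_dcyc arc J'|.
  move=> /minJ; apply: leq_trans; apply/proper_card/properP; split; first exact: subsetDl.
  by exists x; rewrite ?(subsetP SD) // inE xS.
have sJ : state arc P J S.
  split=> //; first by apply/pred0P => z; rewrite /= in_setD; case: (z \in S); rewrite ?andbF.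
  by rewrite /P setUC -{1}(setIidPr SD) setID.
have [I tI minI] := exists_tight P_min sJ.
have G_cut v : linked e (~: [set v]).
  by case: G_2conn => _ /(_ v); rewrite /cut_vertex => nc; apply: contrapT.
have unI := tight_uncrossed arc_oriented G_cubic P_min tI minI.
case: tI => J0 [S0 [IJ0 s0 tI0]].
exact: (tight_contra arc_oriented G_cubic G_bip G_cut P_min IJ0 s0 tI0 unI).
Qed.

End Existence.

Theorem theorem9 (R : realType) (V : finType) (arc : rel V)
    (arc_oriented : oriented arc)
    (G_planar : planar R (underlying arc))
    (G_bipartite : bipartite (underlying arc))
    (G_2connected : two_vertex_connected (underlying arc))
    (G_subcubic : subcubic (underlying arc)) :
  exists A I : {set V}, CAI_partition arc A I.
Proof. exact: CAI_partition_exists. Qed.
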